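(* Let $\gamma\in\mathbb{Z}_{>3}$ and consider a 3-SAT instance with variables $v_0,\dots,v_{n-1}$ and clauses $C_0,\dots,C_{m-1}$ in which every variable appears exactly twice positively and exactly once negatively. For each $i\in[n]_0$ let $j,k\in[m]_0$ be the indices of the clauses containing $v_i$ positively and $\ell$ the index of the clause containing $\neg v_i$, and set $C^{(i)}_{pos1}=\gamma^{j}$, $C^{(i)}_{pos2}=\gamma^{k}$, $C^{(i)}_{neg}=\gamma^{\ell}$; let $$Z=\sum_{i=0}^{n-1}\Big((\gamma^m)^{3i}C^{(i)}_{pos1}+(\gamma^m)^{3i+1}C^{(i)}_{pos2}+(\gamma^m)^{3i+2}C^{(i)}_{neg}\Big).$$ Then there exists an integer linear program $A\mathbf{x}\le\mathbf{b}$ with variable vector $\mathbf{x}=(\boldsymbol\alpha,\boldsymbol\beta,\boldsymbol\chi)\in\mathbb{Z}_{\ge0}^{O(\log n)}$, where $\boldsymbol\alpha=(\alpha_1,\alpha_2,\alpha_3)$, and right-hand side $\mathbf{b}\in\mathbb{Z}^{O(\log n)}$, which has exactly $5n$ feasible solutions, namely: for every $i\in[n]_0$ and every vector $$\boldsymbol\alpha\in\left\{\begin{pmatrix}C^{(i)}_{pos1}\\ \gamma^i\\ 0\end{pmatrix},\begin{pmatrix}C^{(i)}_{pos2}\\ \gamma^i\\ 0\end{pmatrix},\begin{pmatrix}C^{(i)}_{neg}\\ 2\gamma^i\\ 0\end{pmatrix},\begin{pmatrix}0\\ \gamma^i\\ 1\end{pmatrix},\begin{pmatrix}0\\ 0\\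 1\end{pmatrix}\right\}$$ there is exactly one feasible solution, in which $\boldsymbol\chi\in\{0,1\}^{O(1)}$ and $\boldsymbol\beta\in\mathbb{Z}_{\ge0}^{O(\log n)}$ is a vector uniquely determined by $i$ and $Z$ and computable in polynomial time from $i$ and $Z$.
   Context: $[n]_0=\{0,1,\dots,n-1\}$. The $O(\cdot)$ bounds on the number of variables and constraints are uniform over all such instances (in terms of the number $n$ of variables). *)

(* Defs.v *)
From HB Require Import structures.
From mathcomp Require Import all_boot all_order all_algebra.

Set Implicit Arguments.
Unset Strict Implicit.
Unset Printing Implicit Defensive.

Import Order.TTheory GRing.Theory Num.Theory.

Local Open Scope ring_scope.

(* A literal is a pair (v, s): the variable v if s = true, its negation if
   s = false.  A clause is a set of literals, so a variable occurring twice
   positively occurs positively in two different clauses.  3-SAT clauses have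
   at most three literals and are nonempty; they may have fewer than three. *)
Definition literal (n : nat) : finType := ('I_n * bool)%type.

Definition cnf (n m : nat) : Type := 'I_m -> {set literal n}.

Definition is_3sat (n m : nat) (phi : cnf n m) : Prop :=
  forall c : 'I_m, (0 < #|phi c| <= 3)%N.

Definition occurrences (n m : nat) (phi : cnf n m) (v : 'I_n) (s : bool) : nat :=
  #|[set c : 'I_m | (v, s) \in phi c]|.

Definition twice_pos_once_neg (n m : nat) (phi : cnf n m) : Prop :=
  forall v : 'I_n,
    occurrences phi v true = 2%N /\ occurrences phi v false = 1%N.

(* j v and k v are the two clauses containing v (in either order), l v the
   clause containing its negation. *)
Definition occurrence_indices (n m : nat) (phi : cnf n m)
    (j k l : 'I_n -> 'I_m) : Prop :=
  forall v : 'I_n,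
    [set c : 'I_m | (v, true) \in phi c] = [set j v; k v] /\
    [set c : 'I_m | (v, false) \in phi c] = [set l v].

Definition Zval (gamma n m : nat) (j k l : 'I_n -> 'I_m) : nat :=
  (\sum_(i < n) ((gamma ^ m) ^ (3 * i) * gamma ^ j i
               + (gamma ^ m) ^ (3 * i + 1) * gamma ^ k i
               + (gamma ^ m) ^ (3 * i + 2) * gamma ^ l i))%N.

Definition colz (p : nat) (s : seq nat) : 'cV[int]_p :=
  \col_(t < p) (nth 0%N s t)%:Z.

Definition alphas (gamma n m : nat) (j k l : 'I_n -> 'I_m) (i : 'I_n) :
    seq 'cV[int]_3 :=
  [:: colz 3 [:: gamma ^ j i; gamma ^ i; 0]%N;
      colz 3 [:: gamma ^ k i; gamma ^ i; 0]%N;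
      colz 3 [:: gamma ^ l i; 2 * gamma ^ i; 0]%N;
      colz 3 [:: 0; gamma ^ i; 1]%N;
      colz 3 [:: 0; 0; 1]%N].

Definition feasible (r d : nat) (A : 'M[int]_(r, d)) (b : 'cV[int]_r)
    (x : 'cV[int]_d) : bool :=
  [forall t, 0 <= x t 0] && [forall t, (A *m x) t 0 <= b t 0].

Definition alpha_part (p q : nat) (x : 'cV[int]_(3 + (p + q))) : 'cV[int]_3 :=
  usubmx x.
Definition beta_part (p q : nat) (x : 'cV[int]_(3 + (p + q))) : 'cV[int]_p :=
  usubmx (dsubmx x).
Definition chi_part (p q : nat) (x : 'cV[int]_(3 + (p + q))) : 'cV[int]_q :=
  dsubmx (dsubmx x).

(* Length of the binary representation of a, with bitlen 0 = 1; for a >= 1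
   this is also (floor of log_2 a) + 1. *)
Definition bitlen (a : nat) : nat := (trunc_log 2 a).+1.

(* Polynomial time is measured on a random access machine with add, subtract,
   multiply, divide and indirect addressing under the logarithmic cost
   criterion (Aho, Hopcroft and Ullman), which is polynomially equivalent to
   Turing machines.  Registers hold natural numbers, subtraction is truncated,
   and control flow is structured instead of using jumps.  Every step is charged
   the bit lengths of the operands, computed addresses and results it handles;
   the register indices written in the program are O(1) and are not charged. *)
Inductive binop : Type := Add | Sub | Mul | Div.

Definition eval_binop (o : binop) : nat -> nat -> nat :=
  match o with
  | Add => addn | Sub => subn | Mul => muln | Div => divn
  end.

Inductive instr : Type :=
| Const (r c : nat)               (* R[r] := c *)
| Op (o : binop) (r s t : nat)    (* R[r] := R[s] o R[t] *)
| ReadInd (r s : nat)                (* R[r] := R[R[s]] *)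
| WriteInd (r s : nat)               (* R[R[r]] := R[s] *)
| Output (r : nat).                (* append R[r] to the output tape *)

Record state : Type := State { mem : nat -> nat; out : seq nat }.

Definition set_reg (st : state) (r v : nat) : state :=
  State (fun x => if x == r then v else mem st x) (out st).

Definition step (ins : instr) (st : state) : state :=
  let R := mem st in
  match ins with
  | Const r c => set_reg st r c
  | Op o r s t => set_reg st r (eval_binop o (R s) (R t))
  | ReadInd r s => set_reg st r (R (R s))
  | WriteInd r s => set_reg st (R r) (R s)
  | Output r => State R (rcons (out st) (R r))
  end.

Definition cost (ins : instr) (st : state) : nat :=
  let R := mem st in
  match ins with
  | Const _ c => bitlen c
  | Op o _ s t => (bitlen (R s) + bitlen (R t)
                   + bitlen (eval_binop o (R s) (R t)))%N
  | ReadInd _ s => (bitlen (R s) + bitlen (R (R s)))%N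
  | WriteInd r s => (bitlen (R r) + bitlen (R s))%N
  | Output r => bitlen (R r)
  end.

Inductive prog : Type :=
| Skip
| Do (ins : instr)
| Seq (p1 p2 : prog)
| IfNZ (r : nat) (p1 p2 : prog)   (* p1 if R[r] <> 0, otherwise p2 *)
| WhileNZ (r : nat) (p : prog).   (* p as long as R[r] <> 0 *)

(* exec p st st' t: started in st, p halts in st' at total cost t. *)
Inductive exec : prog -> state -> state -> nat -> Prop :=
| ExecSkip st : exec Skip st st 1
| ExecDo ins st : exec (Do ins) st (step ins st) (cost ins st)
| ExecSeq p1 p2 st1 st2 st3 t1 t2 :
    exec p1 st1 st2 t1 -> exec p2 st2 st3 t2 ->
    exec (Seq p1 p2) st1 st3 (t1 + t2)
| ExecIfTrue r p1 p2 st st' t :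
    mem st r <> 0%N -> exec p1 st st' t ->
    exec (IfNZ r p1 p2) st st' (bitlen (mem st r) + t)
| ExecIfFalse r p1 p2 st st' t :
    mem st r = 0%N -> exec p2 st st' t ->
    exec (IfNZ r p1 p2) st st' (bitlen (mem st r) + t)
| ExecWhileTrue r p st1 st2 st3 t1 t2 :
    mem st1 r <> 0%N -> exec p st1 st2 t1 ->
    exec (WhileNZ r p) st2 st3 t2 ->
    exec (WhileNZ r p) st1 st3 (bitlen (mem st1 r) + t1 + t2)
| ExecWhileFalse r p st :
    mem st r = 0%N -> exec (WhileNZ r p) st st (bitlen (mem st r)).

(* The input is placed in registers 0, 1, 2, ..., the others being 0. *)
Definition init (input : seq nat) : state := State (nth 0%N input) [::].

Definition computes_within (P : prog) (input output : seq nat) (t : nat) : Prop :=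
  exists (st : state) (t' : nat),
    [/\ exec P (init input) st t', out st = output & (t' <= t)%N].

(* Main.v *)
Require Import Defs.
From HB Require Import structures.
From mathcomp Require Import all_boot all_order all_algebra.
From mathcomp Require Import zify ring.

Set Implicit Arguments.
Unset Strict Implicit.
Unset Printing Implicit Defensive.

Import Order.TTheory GRing.Theory Num.Theory.

(* Write [g = gamma ^ m] and [X = g ^ 3], so that the [i]-th digit of [Z] in
   base [X] has the base-[g] digits [gamma ^ j i], [gamma ^ k i], [gamma ^ l i].
   Encode [i] by the bits of [e = m - i], where [n <= m].  A chain of [O(log n)]
   big-M inequalities computes [y = X ^ e] from these bits: its [t]-th step
   multiplies by the constant [X ^ 2 ^ t] when bit [t] is 1.  Since [Z * y] is
   linear in [y], the quotient of [Z] by the variable [X ^ i] is that of [Z * y]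
   by the constant [X ^ m], and [gamma ^ i] is the residue of [g * y] modulo the
   constant [gamma * X - 1].  These quotients, remainders and digits are unique
   solutions of linear inequalities, and five binary variables select one of the
   five vectors.
   The machine recovers [m] from [Z]: the base-[gamma] expansion of [Z] has [D]
   digits with sum [3 n], and [m] is [D / (3 n)] rounded up because
   [m <= 3 n]. *)

Local Open Scope ring_scope.
Local Open Scope nat_scope.

(** * Digits of [Z] *)

(** Double counting of literal occurrences: the clause sizes sum to [3 * n], and each clause
    contributes between one and three. *)
Lemma clause_count_bounds (n m : nat) (phi : cnf n m) :
  is_3sat phi -> twice_pos_once_neg phi -> n <= m <= 3 * n.
Proof.
move=> phi3 phi21.
have total : \sum_(c < m) #|phi c| = 3 * n.
  have -> : \sum_(c < m) #|phi c| =
            \sum_(x : literal n) \sum_(c < m) (x \in phi c : nat).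
    rewrite exchange_big; apply: eq_bigr => c _.
    by rewrite -sum1_card big_mkcond; apply: eq_bigr => x _; case: (_ \in _).
  have occ (x : literal n) :
      \sum_(c < m) (x \in phi c : nat) = occurrences phi x.1 x.2.
    rewrite /occurrences -sum1_card [RHS]big_mkcond; apply: eq_bigr => c _.
    by case: x => v s; rewrite inE; case: (_ \in _).
  rewrite (eq_bigr _ (fun x _ => occ x)).
  rewrite -(pair_bigA _ (fun v s => occurrences phi v s)) /=.
  rewrite (eq_bigr (fun=> 3)) ?sum_nat_const ?card_ord 1?mulnC // => v _.
  by rewrite big_bool; have [-> ->] := phi21 v.
apply/andP; split; last first.
  rewrite -total -[leqLHS]card_ord -sum1_card.
  by apply: leq_sum => c _; have /andP[] := phi3 c.
suff : 3 * n <= m * 3 by rewrite mulnC leq_mul2r.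
rewrite -total -[X in _ <= X * 3]card_ord -sum_nat_const.
by apply: leq_sum => c _; have /andP[] := phi3 c.
Qed.

(** [b ^ M * W] is a multiple of [b ^ t.+1], so it does not reach digit [t], whatever the size of
    [U]. *)
Lemma digit_low (b M U W t : nat) : 0 < b -> t < M ->
  (U + b ^ M * W) %/ b ^ t %% b = U %/ b ^ t %% b.
Proof.
move=> b_gt0 lt_tM.
have -> : b ^ M = b ^ (M - t.+1) * b * b ^ t.
  by rewrite -expnSr -expnD; congr (_ ^ _); lia.
rewrite addnC mulnC mulnA divnMDl ?expn_gt0 ?b_gt0 //.
by rewrite (mulnC (b ^ _)) mulnCA mulnC modnMDl.
Qed.

Lemma digit_high (b M U W t : nat) : 0 < b -> U < b ^ M ->
  (U + b ^ M * W) %/ b ^ (M + t) %% b = W %/ b ^ t %% b.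
Proof.
move=> b_gt0 ltU; rewrite expnD divnMA addnC mulnC divnMDl ?expn_gt0 ?b_gt0 //.
by rewrite (divn_small ltU) addn0.
Qed.

Lemma base_sum_ltn (b n : nat) (B : nat -> nat) :
  (forall t, B t < b) -> \sum_(t < n) b ^ t * B t < b ^ n.
Proof.
move=> ltB; elim: n => [|n IHn]; first by rewrite big_ord0.
rewrite big_ord_recr /= -addSn expnSr.
by apply: leq_trans (leq_add IHn (leqnn _)) _; rewrite -mulnS leq_mul2l ltB orbT.
Qed.

Lemma base_sum_digit (b n i : nat) (B : nat -> nat) :
  (forall t, B t < b) -> i < n ->
  (\sum_(t < n) b ^ t * B t) %/ b ^ i %% b = B i.
Proof.
move=> ltB; have b_gt0 : 0 < b by have := ltB 0; lia.
elim: n => // n IHn; rewrite ltnS leq_eqVlt big_ord_recr /=.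
case/predU1P => [->|lt_in]; last by rewrite digit_low ?IHn.
have := digit_high (B n) 0 b_gt0 (base_sum_ltn n ltB).
by rewrite addn0 divn1 [B n %% b]modn_small.
Qed.

Definition digit_sum (b K N : nat) : nat := \sum_(t < K) N %/ b ^ t %% b.

Lemma digit_sumS (b K N : nat) :
  digit_sum b K.+1 N = digit_sum b K N + N %/ b ^ K %% b.
Proof. by rewrite /digit_sum big_ord_recr. Qed.

Lemma digit_sumD (b M K U W : nat) : 0 < b -> U < b ^ M ->
  digit_sum b (M + K) (U + b ^ M * W) = digit_sum b M U + digit_sum b K W.
Proof.
move=> b_gt0 ltU; rewrite /digit_sum big_split_ord /=; congr (_ + _).
  by apply: eq_bigr => t _; rewrite digit_low.
by apply: eq_bigr => t _; rewrite digit_high.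
Qed.

Lemma digit_sum0 (b K : nat) : digit_sum b K 0 = 0.
Proof. by rewrite /digit_sum big1 // => t _; rewrite div0n mod0n. Qed.

Lemma digit_sum_stable (b M K N : nat) :
  0 < b -> N < b ^ M -> M <= K -> digit_sum b K N = digit_sum b M N.
Proof.
move=> b_gt0 ltN /subnKC <-.
by rewrite -[in LHS](addn0 N) -(muln0 (b ^ M)) digit_sumD // digit_sum0 addn0.
Qed.

Lemma digit_sum_exp (b M a : nat) : 1 < b -> a < M -> digit_sum b M (b ^ a) = 1.
Proof.
move=> b_gt1 lt_aM; have b_gt0 := ltnW b_gt1.
(* [b ^ a] is read as [0 + b ^ a * 1]: zeros in the low [a] positions, then the digit 1. *)
rewrite -(subnKC lt_aM) addSnnS -[b ^ a]muln1 -[b ^ a * 1]add0n.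
rewrite digit_sumD ?expn_gt0 ?b_gt0 // digit_sum0 add0n.
rewrite /digit_sum big_ord_recl big1 /= ?divn1 ?modn_small // => t _.
rewrite divn_small ?mod0n //.
by have := ltn_exp2l 0 (lift ord0 t) b_gt1; rewrite expn0 => ->.
Qed.

(* The number of base-[b] digits of [N], which is 0 for [N = 0]. *)
Definition digits (b N : nat) : nat := if N is 0 then 0 else (trunc_log b N).+1.

Lemma digits_ltn (b N t : nat) : 1 < b -> (t < digits b N) = (b ^ t <= N).
Proof.
move=> b_gt1; case: N => [|N] /=.
  by rewrite ltn0 leqn0 expn_eq0; case: b b_gt1.
rewrite ltnS; apply/idP/idP => [le_t|]; last exact: trunc_log_max.
by apply: leq_trans (trunc_logP b_gt1 (ltn0Sn N)); rewrite leq_exp2l.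
Qed.

Lemma digits_div0 (b N t : nat) : 1 < b -> (N %/ b ^ t == 0) = (digits b N <= t).
Proof.
move=> b_gt1; rewrite leqNgt digits_ltn // -divn_gt0 ?expn_gt0 ?(ltnW b_gt1) //.
by rewrite lt0n negbK.
Qed.

Definition block (g : nat) (x y z : nat) : nat := x + g * (y + g * z).

Lemma block_ltn (g x y z : nat) :
  x < g -> y < g -> z < g -> block g x y z < g * g * g.
Proof.
rewrite /block => ltx lty ltz.
have h1 : y + g * z < g * g.
  apply: leq_trans (_ : g + g * z <= _); first by rewrite -addSn leq_add2r.
  by rewrite -mulnS leq_mul2l ltz orbT.
apply: leq_trans (_ : g + g * (y + g * z) <= _); first by rewrite -addSn leq_add2r.
by rewrite -mulnS -mulnA leq_mul2l h1 orbT.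
Qed.

(* The number of clauses, as recovered from [Z]: its base-[gamma] expansion has
   [3 * n] ones and the leading one lies in the last of [3 * n] blocks of
   length [m <= 3 * n]. *)
Definition width (gamma Z : nat) : nat :=
  let D := digits gamma Z in let s := digit_sum gamma D Z in (D + s - 1) %/ s.

(** The default 0 extends the blocks to all naturals, as [base_sum_digit] asks for a bound on every
    digit. *)
Definition blockval (gamma n m : nat) (j k l : 'I_n -> 'I_m) (t : nat) : nat :=
  if insub t is Some i then
    block (gamma ^ m) (gamma ^ j i) (gamma ^ k i) (gamma ^ l i) else 0.

Lemma blockval_ord (gamma n m : nat) (j k l : 'I_n -> 'I_m) (i : 'I_n) :
  blockval gamma j k l i =
    block (gamma ^ m) (gamma ^ j i) (gamma ^ k i) (gamma ^ l i).
Proof. by rewrite /blockval valK. Qed.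

Lemma blockval_ltn (gamma n m : nat) (j k l : 'I_n -> 'I_m) (t : nat) :
  1 < gamma -> blockval gamma j k l t < gamma ^ (3 * m).
Proof.
move=> gamma_gt1; rewrite /blockval.
case: insub => [i|]; last by rewrite expn_gt0 (ltnW gamma_gt1).
have -> : gamma ^ (3 * m) = gamma ^ m * gamma ^ m * gamma ^ m.
  by rewrite -!expnD; congr (_ ^ _); lia.
by apply: block_ltn; rewrite ltn_exp2l.
Qed.

Lemma Zval_blocks (gamma n m : nat) (j k l : 'I_n -> 'I_m) :
  Zval gamma j k l = \sum_(i < n) (gamma ^ (3 * m)) ^ i * blockval gamma j k l i.
Proof.
apply: eq_bigr => i _; rewrite blockval_ord /block -!expnM !mulnDr -!expnD.
by rewrite -!addnA; congr (_ + (_ + _)); congr (_ ^ _); lia.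
Qed.

Lemma Zval_ltn (gamma n m : nat) (j k l : 'I_n -> 'I_m) :
  1 < gamma -> Zval gamma j k l < gamma ^ (3 * m * n).
Proof.
move=> gamma_gt1; rewrite Zval_blocks (expnM _ (3 * m)).
by apply: base_sum_ltn => t; apply: blockval_ltn.
Qed.

Lemma Zval_geq (gamma n m : nat) (j k l : 'I_n -> 'I_m) :
  1 < gamma -> 0 < n -> gamma ^ (m * (3 * n - 1)) <= Zval gamma j k l.
Proof.
case: n j k l => // n j k l gamma_gt1 _; rewrite /Zval big_ord_recr /=.
rewrite -!expnM -!expnD; set a := m * _.
(* The last summand suffices: with [n.+1] variables its power of [gamma ^ m] has exponent
   [3 * n + 2], that is [3 * n.+1 - 1]. *)
suff : gamma ^ a <= gamma ^ (m * (3 * n + 2) + l ord_max) by lia.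
by rewrite leq_exp2l // /a; nia.
Qed.

(** Each of the [3 * n] powers of [gamma] falls into its own slot of [m] digits, so each contributes
    one digit 1 and no carry arises. *)
Lemma digit_sum_Zval (gamma n m : nat) (j k l : 'I_n -> 'I_m) :
  1 < gamma -> digit_sum gamma (digits gamma (Zval gamma j k l)) (Zval gamma j k l) = 3 * n.
Proof.
move=> gamma_gt1; have gamma_gt0 := ltnW gamma_gt1.
set Z := Zval _ _ _ _; have ltZ := Zval_ltn j k l gamma_gt1.
have ltZD : Z < gamma ^ digits gamma Z by rewrite ltnNge -digits_ltn // ltnn.
have le_D : digits gamma Z <= 3 * m * n.
  by rewrite leqNgt digits_ltn // -ltnNge.
rewrite -(digit_sum_stable gamma_gt0 ltZD le_D) /Z Zval_blocks {Z ltZ ltZD le_D}.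
have dsB (i : 'I_n) : digit_sum gamma (3 * m) (blockval gamma j k l i) = 3.
  rewrite blockval_ord /block.
  have -> : 3 * m = m + (m + m) by lia.
  by rewrite !digit_sumD ?ltn_exp2l // !digit_sum_exp.
have {}dsB (t : nat) : t < n -> digit_sum gamma (3 * m) (blockval gamma j k l t) = 3.
  by move=> lt_tn; apply: (dsB (Ordinal lt_tn)).
have ltB t := @blockval_ltn gamma n m j k l t gamma_gt1.
(* The arguments of [blockval] depend on [n]; an arbitrary digit function [B] lets the induction on
   [n] go through. *)
move: (blockval gamma j k l) dsB ltB => B.
elim: n {j k l} => [|n IHn] dsB ltB; first by rewrite big_ord0 muln0 digit_sum0.
rewrite big_ord_recr /= -expnM mulnSr digit_sumD; first last.
- by rewrite (expnM _ (3 * m)); apply: base_sum_ltn.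
- by [].
rewrite IHn // ?dsB ?mulnS 1?addnC // => t lt_tn.
by apply: dsB; apply: leqW.
Qed.

Lemma digits_Zval_bounds (gamma n m : nat) (j k l : 'I_n -> 'I_m) :
  1 < gamma -> 0 < n ->
  m * (3 * n - 1) < digits gamma (Zval gamma j k l) <= 3 * m * n.
Proof.
move=> gamma_gt1 n_gt0; rewrite digits_ltn // Zval_geq //=.
by rewrite leqNgt digits_ltn // -ltnNge Zval_ltn.
Qed.

Lemma width_Zval (gamma n m : nat) (j k l : 'I_n -> 'I_m) :
  1 < gamma -> 0 < n -> m <= 3 * n -> width gamma (Zval gamma j k l) = m.
Proof.
move=> gamma_gt1 n_gt0 le_m3n; rewrite /width digit_sum_Zval //.
have /andP[] := digits_Zval_bounds j k l gamma_gt1 n_gt0.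
move: (digits _ _) => D lo hi.
(* The remainder is nonnegative by [lo] and [m <= 3 * n], and below [3 * n] by [hi]. *)
have -> : D + 3 * n - 1 = m * (3 * n) + (D + 3 * n - 1 - m * (3 * n)) by nia.
by rewrite divnMDl ?divn_small ?addn0 //; nia.
Qed.

Lemma Zval_digit (gamma n m : nat) (j k l : 'I_n -> 'I_m) (i : 'I_n) :
  1 < gamma ->
  Zval gamma j k l %/ (gamma ^ (3 * m)) ^ i %% gamma ^ (3 * m) =
    block (gamma ^ m) (gamma ^ j i) (gamma ^ k i) (gamma ^ l i).
Proof.
move=> gamma_gt1; rewrite Zval_blocks base_sum_digit ?blockval_ord // => t.
exact: blockval_ltn.
Qed.

(** * Straight-line code and loops of the machine *)

Lemma bitlen_leq (a b : nat) : a <= b -> bitlen a <= bitlen b.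
Proof. by move=> le_ab; rewrite ltnS leq_trunc_log. Qed.

Lemma bitlen_gt0 (a : nat) : 0 < bitlen a.
Proof. by []. Qed.

(* A list describes a memory: the registers beyond its end are 0. *)
Definition lstate : Type := seq nat * seq nat.

Definition lmem (ls : lstate) (r : nat) : nat := nth 0 ls.1 r.

(** A machine memory is a function, so it is compared with a list pointwise. *)
Definition rep (ls : lstate) (st : state) : Prop :=
  (forall r, Defs.mem st r = lmem ls r) /\ out st = ls.2.

Definition lset (ls : lstate) (r v : nat) : lstate := (set_nth 0 ls.1 r v, ls.2).

Definition lstep (ls : lstate) (ins : instr) : lstate :=
  match ins with
  | Const r c => lset ls r c
  | Op o r s t => lset ls r (eval_binop o (lmem ls s) (lmem ls t))
  | ReadInd r s => lset ls r (lmem ls (lmem ls s))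
  | WriteInd r s => lset ls (lmem ls r) (lmem ls s)
  | Output r => (ls.1, rcons ls.2 (lmem ls r))
  end.

Definition bounded (V : nat) (ls : lstate) : bool := all (leq^~ V) ls.1.

(* Only these values can exceed a bound on the previous register contents. *)
Definition new_value (ls : lstate) (ins : instr) : nat :=
  match ins with
  | Const _ c => c
  | Op Add _ s t => lmem ls s + lmem ls t
  | Op Mul _ s t => lmem ls s * lmem ls t
  | _ => 0
  end.

Fixpoint tame (V : nat) (ls : lstate) (p : seq instr) : Prop :=
  if p is ins :: p' then new_value ls ins <= V /\ tame V (lstep ls ins) p' else True.

Definition code (p : seq instr) : prog := foldr (fun ins => Seq (Do ins)) Skip p.

(* [V] bounds all the register contents, so [3 * bitlen V] every step cost. *)
Definition runs (V : nat) (P : prog) (ls ls' : lstate) (t : nat) : Prop :=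
  bounded V ls -> bounded V ls' /\
  forall st, rep ls st -> exists st' t',
    [/\ exec P st st' t', rep ls' st' & t' <= t * (3 * bitlen V)].

Lemma bounded_lmem (V : nat) (ls : lstate) (r : nat) : bounded V ls -> lmem ls r <= V.
Proof.
move=> /allP leV; rewrite /lmem; have [lt_r|ge_r] := ltnP r (size ls.1).
  by apply: leV; apply: mem_nth.
by rewrite nth_default.
Qed.

Lemma bounded_lset (V : nat) (ls : lstate) (r v : nat) :
  bounded V ls -> v <= V -> bounded V (lset ls r v).
Proof.
move=> bV le_v; apply/(all_nthP 0) => x _; rewrite nth_set_nth /=.
by case: eqP => // _; apply: bounded_lmem bV.
Qed.

Lemma rep_lset (ls : lstate) (st : state) (r v : nat) :
  rep ls st -> rep (lset ls r v) (set_reg st r v).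
Proof.
case=> eqm eqo; split=> //= x.
by rewrite /lmem nth_set_nth /= -[nth _ _ _]/(lmem ls x) -eqm.
Qed.

(** Subtraction, division and copying create no value above the current bound, so checking
    [new_value] is enough. A cost is a sum of at most three bit lengths. *)
Lemma lstep_sound (V : nat) (ls : lstate) (ins : instr) :
  bounded V ls -> new_value ls ins <= V ->
  bounded V (lstep ls ins) /\
  forall st, rep ls st ->
    rep (lstep ls ins) (step ins st) /\ cost ins st <= 3 * bitlen V.
Proof.
move=> bV newV; have leV r := @bounded_lmem V ls r bV.
have leB r := bitlen_leq (leV r).
have op_le o r s t : ins = Op o r s t -> eval_binop o (lmem ls s) (lmem ls t) <= V.
  move=> def_ins; move: newV; rewrite def_ins; case: o {def_ins} => //= _.
    by apply: leq_trans (leq_subr _ _) _.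
  by apply: leq_trans (leq_div _ _) _.
split=> [|st [eqm eqo]].
  case: ins newV op_le => [r c|o r s t|r s|r s|r] //= newV op_le;
    try by apply: bounded_lset.
  by apply: bounded_lset => //; apply: op_le.
have rep_st : rep ls st by split.
case: ins newV op_le => [r c|o r s t|r s|r s|r] /= newV op_le; rewrite ?eqm.
- by split; [apply: rep_lset | have := bitlen_leq newV; lia].
- split; first exact: rep_lset.
  by have := bitlen_leq (op_le _ _ _ _ erefl); have := leB s; have := leB t; lia.
- by split; [apply: rep_lset | have := leB s; have := leB (lmem ls s); lia].
- by split; [apply: rep_lset | have := leB s; have := leB r; lia].
- by split; [split; rewrite //= ?eqm ?eqo | have := leB r; lia].
Qed.

(** The extra unit pays for the closing [Skip]. *)
Lemma runs_code (V : nat) (p : seq instr) (ls : lstate) :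
  tame V ls p -> runs V (code p) ls (foldl lstep ls p) (size p).+1.
Proof.
elim: p ls => [|ins p IHp] ls /= => [_ bV|[newV tameV] bV].
  split=> // st rep_st; exists st, 1; split=> //; first exact: ExecSkip.
have [bV1 step1] := lstep_sound bV newV.
have [bV2 steps] := IHp _ tameV bV1; split=> // st rep_st.
have [rep1 cost1] := step1 st rep_st.
have [st' [t [exec_p rep2 le_t]]] := steps _ rep1.
exists st', (cost ins st + t); split=> //; first by apply: ExecSeq exec_p; apply: ExecDo.
by rewrite mulSn leq_add.
Qed.

Lemma runs_seq (V : nat) (P Q : prog) (ls1 ls2 ls3 : lstate) (t1 t2 : nat) :
  runs V P ls1 ls2 t1 -> runs V Q ls2 ls3 t2 -> runs V (Seq P Q) ls1 ls3 (t1 + t2).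
Proof.
move=> runP runQ /runP[/runQ[bV execQ] execP]; split=> // st1 /execP.
move=> [st2 [u1 [exec1 /execQ[st3 [u2 [exec2 rep3 le2]]] le1]]].
exists st3, (u1 + u2); split=> //; first exact: ExecSeq exec1 exec2.
by rewrite mulnDl leq_add.
Qed.

(** [F i] is the exact state after [i] rounds and plays the part of a loop invariant. Each round is
    charged one unit for its test; the last unit is the failing test. *)
Lemma runs_while (V r : nat) (P : prog) (F : nat -> lstate) (N t : nat) :
  (forall i, i < N -> lmem (F i) r <> 0) -> lmem (F N) r = 0 ->
  (forall i, i < N -> runs V P (F i) (F i.+1) t) ->
  runs V (WhileNZ r P) (F 0) (F N) (N * t.+1).+1.
Proof.
elim: N F => [|N IHN] F nz z body bV.
  split=> // st rep_st; exists st, (bitlen (Defs.mem st r)); split=> //.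
    by apply: ExecWhileFalse; rewrite rep_st.1.
  by rewrite rep_st.1 z mul1n (leq_trans (bitlen_leq (leq0n V))) // leq_pmull.
have [bV1 exec1] := body 0 (ltn0Sn N) bV.
have [|||bVN execN] := IHN (fun i => F i.+1) _ _ _ bV1.
- by move=> i lt_iN; apply: nz.
- by [].
- by move=> i lt_iN; apply: body.
split=> // st rep_st.
have [st1 [t1 [ex1 rep1 le1]]] := exec1 st rep_st.
have [st2 [t2 [ex2 rep2 le2]]] := execN st1 rep1.
exists st2, (bitlen (Defs.mem st r) + t1 + t2); split=> //.
  by apply: ExecWhileTrue ex1 ex2; rewrite rep_st.1; apply: nz.
rewrite rep_st.1; have := bitlen_leq (bounded_lmem r bV); rewrite /lmem; nia.
Qed.

(** Trailing zeros leave the described memory unchanged; they serve to give a symbolic run an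
    explicit entry for each register. *)
Lemma runs_computes (V : nat) (P : prog) (input mem' output : seq nat) (t k : nat) :
  all (leq^~ V) input ->
  runs V P (input ++ nseq k 0, [::]) (mem', output) t ->
  computes_within P input output (t * (3 * bitlen V)).
Proof.
move=> leV run; have [|_ exec_P] := run.
  by rewrite /bounded /= all_cat leV; apply/allP => x /nseqP[->].
have [|st [t' [ex [_ out_st] le_t]]] := exec_P (init input).
  split=> // r; rewrite /lmem nth_cat nth_nseq /=.
  by case: ltnP => // ge_r; rewrite nth_default //; case: ifP.
by exists st, t'.
Qed.

(** * The program *)

Lemma runs_code_to (V : nat) (p : seq instr) (ls ls' : lstate) :
  tame V ls p -> foldl lstep ls p = ls' -> runs V (code p) ls ls' (size p).+1.
Proof. by move=> /runs_code + <-. Qed.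

(* Call-by-value: [simpl] duplicates the unevaluated intermediate states. *)
Ltac symbolic_run :=
  cbv beta iota zeta delta
    [tame new_value foldl lstep lset lmem set_nth nth fst snd eval_binop].

(* Register 0 holds [gamma], register 4 holds 1 after initialization. *)
Definition scan_digits : prog :=
  Seq (code [:: Const 4 1; Op Mul 3 2 4])
      (WhileNZ 3 (code [:: Op Mul 7 3 4; Op Div 3 3 0; Op Mul 8 3 0; Op Defs.Sub 7 7 8;
                           Op Add 6 6 7; Op Add 5 5 4; Const 7 0; Const 8 0])).

(** Repeated multiplication is fast enough: [m] is at most the number of digits of [Z]. Afterwards
    register 3 holds [m] and register 5 holds [g]. *)
Definition set_power : prog :=
  Seq (code [:: Op Add 3 5 6; Op Defs.Sub 3 3 4; Op Div 3 3 6; Const 5 1; Op Mul 6 3 4])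
      (WhileNZ 6 (code [:: Op Mul 5 5 0; Op Defs.Sub 6 6 4])).

(** The [i] rounds are polynomial in the length of [Z], though not in that of [i]: [Z] has more than
    [i] digits. *)
Definition shift_value : prog :=
  Seq (code [:: Op Mul 6 5 5; Op Mul 6 6 5; Op Mul 7 1 4])
      (WhileNZ 7 (code [:: Op Div 2 2 6; Op Defs.Sub 7 7 4])).

(** Register 1 holds the unread bits of [e], register 7 the power [X ^ 2 ^ t], register 8 the
    accumulated power. Register 3 is halved from [m] down to 0, so the number of rounds does not
    depend on [i]. *)
Definition output_chain : prog :=
  Seq (code [:: Op Defs.Sub 1 3 1; Op Mul 7 6 4; Const 8 1; Const 9 2; Output 8])
      (WhileNZ 3 (code [:: Op Div 10 1 9; Op Mul 11 10 9; Op Defs.Sub 1 1 11; Output 1;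
                           Op Mul 11 8 7; Op Defs.Sub 11 11 8; Op Mul 11 11 1;
                           Op Add 8 8 11; Output 8; Op Mul 7 7 7; Op Mul 1 10 4;
                           Op Div 3 3 9; Const 10 0; Const 11 0])).

Definition output_digits : prog :=
  code [:: Op Div 7 2 6; Output 7;
           Op Div 10 2 5; Op Mul 11 10 5; Op Defs.Sub 11 2 11; Output 11;
           Op Div 2 10 5; Op Mul 11 2 5; Op Defs.Sub 11 10 11; Output 11;
           Op Div 10 2 5; Op Mul 11 10 5; Op Defs.Sub 11 2 11; Output 11;
           Op Mul 10 5 8; Op Mul 11 0 6; Op Defs.Sub 11 11 4; Op Div 10 10 11; Output 10].

Definition beta_prog : prog :=
  Seq scan_digits (Seq set_power (Seq shift_value (Seq output_chain output_digits))).

(* The exponent [e] is consumed bit by bit, lowest bit first: entry [2 t + 1] is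
   bit [t] and entry [2 t] the power of [X] accumulated from the bits below [t]. *)
Definition chain_entry (X e u : nat) : nat :=
  if odd u then e %/ 2 ^ u./2 %% 2 else X ^ (e %% 2 ^ u./2).

Definition chain (X e L : nat) : seq nat := mkseq (chain_entry X e) (2 * L).+1.

(** The values of the variables [H, c1, c2, c3, Q]: the part of [R] above its lowest base-[X] digit,
    the three base-[g] digits of that digit, and the quotient that yields [gamma ^ i] as a
    remainder. *)
Definition tail_digits (gamma g R y : nat) : seq nat :=
  [:: R %/ (g * g * g); R %% g; R %/ g %% g; R %/ g %/ g %% g;
      g * y %/ (gamma * (g * g * g) - 1)].

(** Since [m < 2 ^ L], the reduction modulo [2 ^ L] changes nothing; it makes the last argument
    literally the last entry of the chain. *)
Definition beta_seq (gamma i Z : nat) : seq nat :=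
  let m := width gamma Z in
  let g := gamma ^ m in let X := g * g * g in let L := digits 2 m in
  chain X (m - i) L ++
    tail_digits gamma g (Z %/ X ^ i) (X ^ ((m - i) %% 2 ^ L)).

(** * Correctness of the program *)

Lemma subn_divM (a b : nat) : a - a %/ b * b = a %% b.
Proof. by rewrite {1}(divn_eq a b) addKn. Qed.

Lemma modn_exp2S (e k : nat) :
  e %% 2 ^ k.+1 = e %% 2 ^ k + 2 ^ k * (e %/ 2 ^ k %% 2).
Proof.
apply/eqP; rewrite -(eqn_add2l (e %/ 2 ^ k.+1 * 2 ^ k.+1)) -divn_eq.
rewrite {1}(divn_eq e (2 ^ k)) {1}(divn_eq (e %/ 2 ^ k) 2) -divnMA -expnSr.
by rewrite mulnDl -mulnA -expnS (mulnC (2 ^ k)) addnAC addnA.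
Qed.

Lemma chain0 (X e : nat) : chain X e 0 = [:: 1].
Proof. by rewrite /chain /mkseq /= /chain_entry /= expn0 modn1. Qed.

Lemma chainS (X e L : nat) :
  chain X e L.+1 =
    rcons (rcons (chain X e L) (e %/ 2 ^ L %% 2)) (X ^ (e %% 2 ^ L.+1)).
Proof.
rewrite /chain mulnS !addSn add0n !mkseqS /chain_entry /= mul2n odd_double /=.
by rewrite uphalf_double doubleK.
Qed.

Lemma scan_digits_runs (V gamma i Z : nat) :
  1 < gamma -> Z <= V -> 0 < V ->
  digits gamma Z + digit_sum gamma (digits gamma Z) Z <= V ->
  runs V scan_digits ([:: gamma; i; Z] ++ nseq 9 0, [::])
    ([:: gamma; i; Z; 0; 1; digits gamma Z; digit_sum gamma (digits gamma Z) Z;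
         0; 0; 0; 0; 0], [::])
    (3 + (digits gamma Z * 10).+1).
Proof.
move=> gamma_gt1 leZV V_gt0; set D := digits _ _ => leDsV.
(* After [k] rounds register 3 holds the unread high part of [Z]. The body clears its scratch
   registers 7 and 8, so all these states have the same shape. *)
pose F k : lstate := ([:: gamma; i; Z; Z %/ gamma ^ k; 1; k; digit_sum gamma k Z;
                         0; 0; 0; 0; 0], [::]).
have -> : ([:: gamma; i; Z; 0; 1; D; digit_sum gamma D Z; 0; 0; 0; 0; 0], [::]) = F D.
  by congr (_, _); congr [:: _, _, _, _ & _]; apply/esym/eqP; rewrite digits_div0.
apply: (runs_seq (ls2 := F 0)).
  apply: runs_code_to; first by symbolic_run; rewrite muln1.
  by rewrite /F; symbolic_run; rewrite divn1 muln1 /digit_sum big_ord0.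
apply: (runs_while (t := 9)).
- by move=> k lt_kD; apply/eqP; rewrite digits_div0 // -ltnNge.
- by apply/eqP; rewrite digits_div0.
move=> k lt_kD; have leT : Z %/ gamma ^ k <= V by apply: leq_trans (leq_div _ _) _.
have le_s : digit_sum gamma k Z + Z %/ gamma ^ k %% gamma <= V.
  rewrite -digit_sumS; apply: leq_trans leDsV; apply: leq_trans (leq_addl _ _).
  rewrite -(subnKC lt_kD) /digit_sum big_split_ord /=; exact: leq_addr.
apply: runs_code_to.
  rewrite /F; symbolic_run; rewrite muln1 subn_divM; repeat split=> //.
    by apply: leq_trans leT; apply: leq_divM.
  by rewrite addn1; apply: leq_trans leDsV; apply: leq_trans lt_kD _; apply: leq_addr.
rewrite /F; symbolic_run; rewrite muln1 subn_divM addn1 -digit_sumS expnSr divnMA //.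
Qed.

Lemma set_power_runs (V gamma i Z D s : nat) (m := (D + s - 1) %/ s) :
  0 < gamma -> D + s <= V -> m <= V -> gamma ^ m <= V ->
  runs V set_power ([:: gamma; i; Z; 0; 1; D; s; 0; 0; 0; 0; 0], [::])
    ([:: gamma; i; Z; m; 1; gamma ^ m; 0; 0; 0; 0; 0; 0], [::])
    (6 + (m * 4).+1).
Proof.
move=> gamma_gt0 leDsV lemV legV; have V_gt0 : 0 < V.
  by apply: leq_trans legV; rewrite expn_gt0 gamma_gt0.
pose F k : lstate := ([:: gamma; i; Z; m; 1; gamma ^ k; m - k;
                         0; 0; 0; 0; 0], [::]).
have -> : ([:: gamma; i; Z; m; 1; gamma ^ m; 0; 0; 0; 0; 0; 0], [::]) = F m.
  by rewrite /F subnn.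
apply: (runs_seq (ls2 := F 0)).
  apply: runs_code_to; first by symbolic_run; rewrite -/m muln1.
  by rewrite /F; symbolic_run; rewrite -/m muln1 subn0.
apply: (runs_while (t := 3)).
- by move=> k lt_km; apply/eqP; rewrite /lmem /= subn_eq0 -ltnNge.
- by rewrite /lmem /= subnn.
move=> k lt_km; apply: runs_code_to.
  rewrite /F; symbolic_run; rewrite -expnSr; split=> //.
  by apply: leq_trans legV; rewrite leq_pexp2l.
by rewrite /F; symbolic_run; rewrite -expnSr subn1 subnS.
Qed.

Lemma shift_value_runs (V gamma i Z m g : nat) (X := g * g * g) :
  g * g <= V -> X <= V -> i <= V ->
  runs V shift_value ([:: gamma; i; Z; m; 1; g; 0; 0; 0; 0; 0; 0], [::])
    ([:: gamma; i; Z %/ X ^ i; m; 1; g; X; 0; 0; 0; 0; 0], [::])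
    (4 + (i * 4).+1).
Proof.
move=> leggV leXV leiV.
pose F k : lstate := ([:: gamma; i; Z %/ X ^ k; m; 1; g; X; i - k;
                         0; 0; 0; 0], [::]).
have -> : ([:: gamma; i; Z %/ X ^ i; m; 1; g; X; 0; 0; 0; 0; 0], [::]) = F i.
  by rewrite /F subnn.
apply: (runs_seq (ls2 := F 0)).
  apply: runs_code_to; first by symbolic_run; rewrite muln1.
  by rewrite /F; symbolic_run; rewrite muln1 subn0 divn1.
apply: (runs_while (t := 3)).
- by move=> k lt_ki; apply/eqP; rewrite /lmem /= subn_eq0 -ltnNge.
- by rewrite /lmem /= subnn.
move=> k lt_ki; apply: runs_code_to; first by rewrite /F; symbolic_run.
by rewrite /F; symbolic_run; rewrite expnSr divnMA subn1 subnS.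
Qed.

Lemma output_chain_runs (V gamma i R m g X : nat) (L := digits 2 m) :
  0 < X -> 1 < V -> m <= V -> X * X ^ 2 ^ L <= V ->
  runs V output_chain ([:: gamma; i; R; m; 1; g; X; 0; 0; 0; 0; 0], [::])
    ([:: gamma; (m - i) %/ 2 ^ L; R; 0; 1; g; X; X ^ 2 ^ L;
         X ^ ((m - i) %% 2 ^ L); 2; 0; 0], chain X (m - i) L)
    (6 + (L * 16).+1).
Proof.
move=> X_gt0 V_gt1 lemV leXV; set e := m - i.
pose F k : lstate :=
  ([:: gamma; e %/ 2 ^ k; R; m %/ 2 ^ k; 1; g; X; X ^ 2 ^ k; X ^ (e %% 2 ^ k); 2; 0; 0],
   chain X e k).
have le_XV k : k <= 2 ^ L -> X ^ k <= V.
  move=> le_k; apply: leq_trans leXV; apply: leq_trans (leq_pmull _ X_gt0).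
  by rewrite leq_pexp2l.
have -> : ([:: gamma; e %/ 2 ^ L; R; 0; 1; g; X; X ^ 2 ^ L;
         X ^ (e %% 2 ^ L); 2; 0; 0], chain X e L) = F L.
  by congr (_, _); congr [:: _, _, _, _ & _]; apply/esym/eqP; rewrite digits_div0.
apply: (runs_seq (ls2 := F 0)).
  apply: runs_code_to.
    symbolic_run; rewrite muln1; repeat split=> //; last exact: ltnW.
    by have := le_XV 1; rewrite expn1; apply; rewrite expn_gt0.
  by rewrite /F; symbolic_run; rewrite muln1 expn0 !divn1 modn1 chain0.
apply: (runs_while (t := 15)).
- by move=> k lt_kL; apply/eqP; rewrite digits_div0 // -ltnNge.
- by apply/eqP; rewrite digits_div0.
move=> k lt_kL.
have lt2 : e %/ 2 ^ k %% 2 < 2 by rewrite ltn_mod.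
(* The product has exponent at most [2 ^ k.+1], and [k < L]. *)
have le_yG : X ^ (e %% 2 ^ k) * X ^ 2 ^ k <= V.
  rewrite -expnD; apply: le_XV; apply: leq_trans (_ : 2 ^ k.+1 <= _).
    by rewrite expnS mul2n -addnn leq_add2r ltnW // ltn_mod expn_gt0.
  by rewrite leq_exp2l.
have le_diff : (X ^ (e %% 2 ^ k) * X ^ 2 ^ k - X ^ (e %% 2 ^ k)) * (e %/ 2 ^ k %% 2)
    <= X ^ (e %% 2 ^ k) * X ^ 2 ^ k - X ^ (e %% 2 ^ k).
  by rewrite -[leqRHS]muln1 leq_mul2l -ltnS lt2 orbT.
have le_y : X ^ (e %% 2 ^ k) <= X ^ (e %% 2 ^ k) * X ^ 2 ^ k.
  by rewrite leq_pmulr // expn_gt0 X_gt0.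
have next_y : X ^ (e %% 2 ^ k) +
    (X ^ (e %% 2 ^ k) * X ^ 2 ^ k - X ^ (e %% 2 ^ k)) * (e %/ 2 ^ k %% 2) =
    X ^ (e %% 2 ^ k.+1).
  (* The branch-free update keeps the power when the bit is 0 and multiplies it by [X ^ 2 ^ k] when
     the bit is 1. *)
  rewrite modn_exp2S expnD; move: lt2 le_y; case: (_ %% 2) => [|[|b]] // _ le_y.
    by rewrite !muln0 addn0 muln1.
  by rewrite !muln1 subnKC.
apply: runs_code_to.
  rewrite /F; symbolic_run; rewrite !muln1 subn_divM; repeat split=> //.
  - apply: leq_trans (leq_divM _ _) _; apply: leq_trans (leq_div _ _) _.
    by apply: leq_trans (leq_subr _ _) _.
  - by apply: leq_trans le_diff _; apply: leq_trans (leq_subr _ _) _.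
  - rewrite next_y; apply: le_XV; apply: leq_trans (_ : 2 ^ k.+1 <= _).
      by rewrite ltnW // ltn_mod expn_gt0.
    by rewrite leq_exp2l.
  - by rewrite -expnD addnn -mul2n -expnS; apply: le_XV; rewrite leq_exp2l.
  - apply: leq_trans (leq_div _ _) _; apply: leq_trans (leq_div _ _) _.
    by apply: leq_trans (leq_subr _ _) _.
rewrite /F; symbolic_run.
by rewrite !muln1 subn_divM next_y chainS -!divnMA -!(expnSr 2) -expnD addnn -mul2n -expnS.
Qed.

Lemma output_digits_runs (V gamma e R g X G y : nat) (o : seq nat) :
  X = g * g * g -> R <= V -> gamma * X <= V -> g * y <= V ->
  exists mem', runs V output_digits
    ([:: gamma; e; R; 0; 1; g; X; G; y; 2; 0; 0], o)
    (mem', o ++ tail_digits gamma g R y) 20.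
Proof.
move=> defX leRV legXV legyV; eexists; apply: runs_code_to; last first.
  symbolic_run; rewrite !subn_divM; congr (_, _).
  by rewrite /tail_digits -defX -!cats1 -!catA.
have le3 a b c : R %/ a %/ b %/ c <= V.
  by do 3![apply: leq_trans (leq_div _ _) _].
symbolic_run; repeat split=> //; apply: leq_trans (leq_divM _ _) _ => //.
  by have := le3 1 1 g; rewrite !divn1.
by have := le3 1 g g; rewrite !divn1.
Qed.

(** In the last bound on [V], [X ^ 2 ^ L] covers the chain, the further factor [X] covers the
    product [g * y], and [gamma] covers [gamma * X]. *)
Lemma beta_prog_computes (V gamma i Z : nat) :
  let m := width gamma Z in let D := digits gamma Z in
  let X := gamma ^ m * gamma ^ m * gamma ^ m in let L := digits 2 m in
  1 < gamma -> i <= V -> Z <= V -> D + digit_sum gamma D Z <= V -> m <= V ->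
  gamma * (X * X ^ 2 ^ L) <= V ->
  computes_within beta_prog [:: gamma; i; Z] (beta_seq gamma i Z)
    ((10 * D + 4 * m + 4 * i + 16 * L + 60) * (3 * bitlen V)).
Proof.
move=> m D X L gamma_gt1 leiV leZV leDsV lemV leXV.
have gamma_gt0 : 0 < gamma := ltnW gamma_gt1.
have g_gt0 : 0 < gamma ^ m by rewrite expn_gt0 gamma_gt0.
have X_gt0 : 0 < X by rewrite !muln_gt0 g_gt0.
have powX_gt0 a : 0 < X ^ a by rewrite expn_gt0 X_gt0.
have leXXV : X * X ^ 2 ^ L <= V by apply: leq_trans leXV; rewrite leq_pmull.
have legXV : gamma * X <= V.
  by apply: leq_trans leXV; rewrite leq_mul2l leq_pmulr ?orbT.
have le_gV : gamma <= V by apply: leq_trans legXV; rewrite leq_pmulr.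
have leX : X <= V by apply: leq_trans legXV; rewrite leq_pmull.
have leggX : gamma ^ m * gamma ^ m <= X by rewrite leq_pmulr.
have leg : gamma ^ m <= X by apply: leq_trans leggX; rewrite leq_pmulr.
have V_gt1 : 1 < V by apply: leq_trans le_gV.
have legy : gamma ^ m * X ^ ((m - i) %% 2 ^ L) <= V.
  apply: leq_trans leXXV; apply: leq_mul => //.
  by rewrite leq_pexp2l // ltnW // ltn_mod expn_gt0.
have [mem' run5] := output_digits_runs ((m - i) %/ 2 ^ L) (X ^ 2 ^ L)
  (chain X (m - i) L) (erefl X) (leq_trans (leq_div Z (X ^ i)) leZV) legXV legy.
have run4 :=
  @output_chain_runs V gamma i (Z %/ X ^ i) m (gamma ^ m) X X_gt0 V_gt1 lemV leXXV.
have run3 := @shift_value_runs V gamma i Z m (gamma ^ m) (leq_trans leggX leX) leX leiV.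
have run2 : runs V set_power _ _ (6 + (m * 4).+1) :=
  @set_power_runs V gamma i Z D _ gamma_gt0 leDsV lemV (leq_trans leg leX).
have run1 := @scan_digits_runs V gamma i Z gamma_gt1 leZV (ltnW V_gt1) leDsV.
have := runs_seq run1 (runs_seq run2 (runs_seq run3 (runs_seq run4 run5))).
move=> /runs_computes; rewrite /= le_gV leiV leZV => /(_ isT).
case=> st [t [exec_P out_st le_t]]; exists st, t; split=> //.
by apply: leq_trans le_t _; rewrite leq_mul2r; apply/orP; right; lia.
Qed.

(** * Polynomial running time *)

Lemma bitlen_exp2 (a : nat) : bitlen (2 ^ a) = a.+1.
Proof. by rewrite /bitlen trunc_expnK. Qed.

Lemma digits_exp_leq (b N : nat) : 1 < b -> 0 < N -> b ^ digits b N <= b * N.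
Proof.
move=> b_gt1; case: N => // N _; rewrite expnS leq_mul2l trunc_logP ?orbT //.
Qed.

Lemma digits_leq (b N : nat) : 1 < b -> digits b N <= N.
Proof.
move=> b_gt1; rewrite leqNgt digits_ltn // -ltnNge; exact: ltn_expl.
Qed.

Lemma digits_bitlen (b N : nat) : 1 < b -> digits b N <= bitlen N.
Proof.
move=> b_gt1; rewrite leqNgt digits_ltn // -ltnNge.
apply: leq_trans (trunc_log_ltn N (ltnSn 1)) _.
by rewrite leq_exp2r.
Qed.

(** [Z] has more than [m * (3 * n - 1)] digits, so [m], [n] and all loop counts are linear in its
    bit length; intermediate values have cubic bit length. *)
Lemma beta_time (gamma n m : nat) (phi : cnf n m) (j k l : 'I_n -> 'I_m) (i : 'I_n) :
  1 < gamma -> is_3sat phi -> twice_pos_once_neg phi ->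
  let Z := Zval gamma j k l in
  computes_within beta_prog [:: gamma; nat_of_ord i; Z] (beta_seq gamma i Z)
    (3300 * (bitlen i + bitlen Z) ^ 4).
Proof.
move=> gamma_gt1 phi3 phi21 Z.
have /andP[le_nm le_m3n] := clause_count_bounds phi3 phi21.
have n_gt0 : 0 < n := leq_ltn_trans (leq0n i) (ltn_ord i).
have defm := width_Zval j k l gamma_gt1 n_gt0 le_m3n.
have defs := digit_sum_Zval j k l gamma_gt1.
have /andP[lo _] := digits_Zval_bounds j k l gamma_gt1 n_gt0.
have leDB := digits_bitlen Z gamma_gt1.
rewrite -/Z in defm defs lo; set D := digits gamma Z in defs lo leDB *.
set B := bitlen Z in leDB *; set S := bitlen i + B.
have le_DS : D <= S by apply: leq_trans leDB _; apply: leq_addl.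
have le_sD : 3 * n <= D by nia.
have le_mD : m <= D by nia.
have lt_in := ltn_ord i.
have le_Lm : digits 2 m <= m := digits_leq m (ltnSn 1).
have m_gt0 : 0 < m by apply: leq_trans le_nm.
have le_2L : 2 ^ digits 2 m <= 2 * m by apply: digits_exp_leq.
have ltZ : Z < 2 ^ B := trunc_log_ltn Z (ltnSn 1).
(* The size [S] does not count the input [gamma], which is therefore bounded through [Z]. *)
have le_gZ : gamma <= Z.
  apply: leq_trans (Zval_geq j k l gamma_gt1 n_gt0).
  by rewrite -[leqLHS]expn1 leq_exp2l //; nia.
have S_gt1 : 1 < S by rewrite /S; have := bitlen_gt0 i; have := bitlen_gt0 Z; lia.
(* The largest value is a power of [gamma] with exponent [1 + 3 * m + 3 * m * 2 ^ L], at most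
   [10 * S ^ 2] as [2 ^ L <= 2 * m]; moreover [gamma <= Z < 2 ^ B]. *)
pose V := 2 ^ (10 * S ^ 3).
have S_leV a : a <= 10 * S ^ 3 -> a <= V.
  by move=> le_a; apply: ltnW; apply: leq_ltn_trans le_a _; apply: ltn_expl.
have sq : S * S * S = S ^ 3 by rewrite !expnS expn0 muln1 mulnA.
have leSS : 4 * S <= S ^ 3 by rewrite -sq; nia.
have [] := @beta_prog_computes V gamma i Z gamma_gt1; rewrite ?defm -/D ?defs.
- by apply: S_leV; lia.
- apply: leq_trans (ltnW ltZ) _; rewrite leq_exp2l //.
  by have : B <= S := leq_addl _ _; lia.
- by apply: S_leV; lia.
- by apply: S_leV; lia.
- rewrite -!expnD -expnM -expnD -expnS.
  apply: leq_trans (_ : (2 ^ B) ^ (10 * S ^ 2) <= _); last first.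
    rewrite -expnM leq_exp2l // mulnCA leq_mul2l /= -sq (expnS S 1) expn1.
    by rewrite -mulnA leq_mul2r leq_addl orbT.
  apply: leq_trans (_ : gamma ^ (10 * S ^ 2) <= _); last first.
    by rewrite leq_exp2r ?muln_gt0 ?expn_gt0 ?(ltnW S_gt1) // ltnW // (leq_ltn_trans le_gZ).
  rewrite leq_exp2l // (expnS S 1) expn1.
  have le_mS : m <= S by lia.
  nia.
move=> st [t [exec_P out_st le_t]]; exists st, t; split=> //.
apply: leq_trans le_t _; rewrite /V bitlen_exp2.
(* There are at most [100 * S] units, each worth [3 * (10 * S ^ 3 + 1)]; the product of 100 and 33
   gives 3300. *)
apply: leq_trans (_ : (100 * S) * (33 * S ^ 3) <= _).
  by apply: leq_mul; lia.
by rewrite (expnS S 3); nia.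
Qed.

(** * Linear programs over the naturals *)

(* An inequality [sum + c <= sum' + c'] between affine forms with natural
   coefficients; a pair [(a, u)] stands for the term [a * v u]. *)
Definition affine : Type := seq (nat * nat) * nat.

Definition eval (f : affine) (v : nat -> nat) : nat :=
  \sum_(p <- f.1) p.1 * v p.2 + f.2.

Definition constraint : Type := affine * affine.

Definition holds (v : nat -> nat) (c : constraint) : bool := eval c.1 v <= eval c.2 v.

Definition coef (f : affine) (u : nat) : nat := \sum_(p <- f.1 | p.2 == u) p.1.

Definition trivial_constraint : constraint := (([::], 0), ([::], 0)).

Definition ilp_matrix (d : nat) (cs : seq constraint) : 'M[int]_(size cs, d) :=
  (\matrix_(t, u) ((coef (nth trivial_constraint cs t).1 u)%:Z
                   - (coef (nth trivial_constraint cs t).2 u)%:Z))%R.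

Definition ilp_rhs (cs : seq constraint) : 'cV[int]_(size cs) :=
  (\col_t ((nth trivial_constraint cs t).2.2%:Z
           - (nth trivial_constraint cs t).1.2%:Z))%R.

(** A total valuation on naturals, faithful on nonnegative vectors. *)
Definition entry (d : nat) (x : 'cV[int]_d) (u : nat) : nat :=
  if insub u is Some w then `|x w ord0|%N else 0.

Lemma entry_ord (d : nat) (x : 'cV[int]_d) (w : 'I_d) :
  (0 <= x w ord0)%R -> (entry x w)%:Z = x w ord0.
Proof. by move=> x_ge0; rewrite /entry valK; lia. Qed.

Lemma coef_entry (d : nat) (x : 'cV[int]_d) (f : affine) :
  (forall w, (0 <= x w ord0)%R) ->
  (\sum_(w < d) (coef f w)%:Z * x w ord0)%R =
    (\sum_(p <- f.1) p.1 * entry x p.2)%N%:Z.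
Proof.
move=> x_ge0; case: f => s c; rewrite /coef /= {c}.
elim: s => [|[a u] s IHs]; first by rewrite big_nil big1 // => w _; rewrite big_nil mul0r.
rewrite big_cons PoszD -IHs /=.
rewrite (eq_bigr (fun w : 'I_d => (if u == w then a%:Z * x w ord0 else 0)
  + (\sum_(p <- s | p.2 == w) p.1)%N%:Z * x w ord0)%R); last first.
  by move=> w _; rewrite big_cons /=; case: eqP => _; rewrite ?PoszD ?mulrDl ?add0r.
rewrite big_split /=; congr (_ + _)%R; rewrite -big_mkcond /=.
have [lt_ud|le_du] := ltnP u d.
  rewrite (big_pred1 (Ordinal lt_ud)) => [|w]; last by rewrite /= -val_eqE eq_sym.
  by rewrite PoszM -[u in entry x u]/(val (Ordinal lt_ud)) entry_ord.
(* A variable beyond [d] has no column, in agreement with its value 0 under [entry]. *)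
rewrite big_pred0 => [|w]; last by apply/eqP => def_u; have := ltn_ord w; lia.
by rewrite /entry insubN ?muln0 // -leqNgt.
Qed.

Lemma feasible_ilp (d : nat) (cs : seq constraint) (x : 'cV[int]_d) :
  feasible (ilp_matrix d cs) (ilp_rhs cs) x =
    [forall w, (0 <= x w ord0)%R] && all (holds (entry x)) cs.
Proof.
rewrite /feasible; apply: andb_id2l => /forallP x_ge0.
have rowE (t : 'I_(size cs)) :
    ((ilp_matrix d cs *m x) t ord0 <= ilp_rhs cs t ord0)%R =
    holds (entry x) (nth trivial_constraint cs t).
  rewrite !mxE; under eq_bigr => w _ do rewrite mxE mulrBl.
  by rewrite sumrB !coef_entry // /holds /eval; lia.
apply/forallP/(all_nthP trivial_constraint) => [hold t lt_t|hold t].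
  by have := hold (Ordinal lt_t); rewrite rowE.
by rewrite rowE; apply: hold.
Qed.

Lemma entry_colz (d : nat) (s : seq nat) (u : nat) :
  size s = d -> entry (colz d s) u = nth 0 s u.
Proof.
move=> <-; rewrite /entry; case: insubP => [w _ <-|]; first by rewrite mxE.
by rewrite -leqNgt => le_u; rewrite nth_default.
Qed.

Lemma colz_inj (d : nat) (s s' : seq nat) :
  size s = d -> size s' = d -> colz d s = colz d s' -> s = s'.
Proof.
move=> size_s size_s' eq_s; apply: (@eq_from_nth _ 0); first by rewrite size_s.
by move=> u _; rewrite -(entry_colz u size_s) eq_s entry_colz.
Qed.

Lemma colz_entry (d : nat) (x : 'cV[int]_d) (s : seq nat) :
  (forall w, (0 <= x w ord0)%R) -> (forall u, u < d -> entry x u = nth 0 s u) ->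
  x = colz d s.
Proof.
move=> x_ge0 eq_x; apply/colP => w; rewrite mxE -eq_x //.
by rewrite -[LHS]entry_ord.
Qed.

Lemma colz_parts (p q : nat) (a b c : seq nat) : size a = 3 -> size b = p ->
  let x := colz (3 + (p + q)) (a ++ b ++ c) in
  [/\ alpha_part x = colz 3 a, beta_part x = colz p b & chi_part x = colz q c].
Proof.
move=> size_a size_b; split; apply/colP => u; rewrite !mxE; congr Posz.
- by rewrite -[LHS]/(nth 0 (a ++ b ++ c) u) nth_cat size_a ltn_ord.
- rewrite -[LHS]/(nth 0 (a ++ b ++ c) (3 + u)) nth_cat size_a ltnNge leq_addr /= addKn.
  by rewrite nth_cat size_b ltn_ord.
rewrite -[LHS]/(nth 0 (a ++ b ++ c) (3 + (p + u))) nth_cat size_a ltnNge leq_addr /= addKn.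
by rewrite nth_cat size_b ltnNge leq_addr /= addKn.
Qed.

(** * The linear program of an instance *)

(** For a constant divisor both bounds are linear; this is how quotients enter the program. *)
Lemma divn_eq_bounds (a d q : nat) : 0 < d ->
  (q * d <= a < q.+1 * d) = (a %/ d == q).
Proof. by move=> d_gt0; rewrite -leq_divRL // -ltn_divLR // eqn_leq andbC ltnS. Qed.

(* Multiplying by [X ^ (m - i)] and dividing by the constant [X ^ m] replaces
   the division by the variable [X ^ i]. *)
Lemma shift_bounds (X m i Z B : nat) : 0 < X -> i <= m ->
  (X ^ m * B <= Z * X ^ (m - i) < X ^ m * B + X ^ m) = (Z %/ X ^ i == B).
Proof.
move=> X_gt0 le_im; rewrite -divn_eq_bounds ?expn_gt0 ?X_gt0 // -mulnSr.
rewrite -(subnK le_im) expnD (addnK i) (mulnC Z) -!mulnA.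
by rewrite leq_pmul2l ?ltn_pmul2l ?expn_gt0 ?X_gt0 // ![X ^ i * _]mulnC.
Qed.

Lemma digits3 (g c1 c2 c3 h : nat) : c1 < g -> c2 < g -> c3 < g ->
  let R := c1 + g * (c2 + g * (c3 + g * h)) in
  [/\ R %% g = c1, R %/ g %% g = c2, R %/ g %/ g %% g = c3 & R %/ (g * g * g) = h].
Proof.
move=> lt1 lt2 lt3; have g_gt0 : 0 < g by apply: leq_ltn_trans lt1.
have divg a c : a < g -> (a + g * c) %/ g = c.
  by move=> lta; rewrite addnC mulnC divnMDl // divn_small ?addn0.
have modg a c : a < g -> (a + g * c) %% g = a.
  by move=> lta; rewrite addnC mulnC modnMDl modn_small.
by rewrite /= !divnMA !divg // !modg.
Qed.

(* Modulo [gamma * X - 1] the number [gamma] is an inverse of [X]. *)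
Lemma inverse_power (gamma g X m i : nat) :
  2 < gamma -> 0 < X -> i <= m -> g = gamma ^ m -> g <= X ->
  g * X ^ (m - i) %% (gamma * X - 1) = gamma ^ i.
Proof.
move=> gamma_gt2 X_gt0 le_im def_g le_gX; have gamma_gt0 : 0 < gamma by lia.
have -> : g * X ^ (m - i) = gamma ^ i * (gamma * X) ^ (m - i).
  by rewrite def_g -{1}(subnKC le_im) expnD expnMn mulnA.
have lt_i : gamma ^ i < gamma * X - 1.
  have : gamma ^ i <= g by rewrite def_g leq_pexp2l.
  by nia.
have -> : gamma * X = (gamma * X - 1) + 1 by nia.
by rewrite addnK -modnMmr -modnXm modnDl modnXm exp1n modnMmr muln1 modn_small.
Qed.

(** For bit 0 the second and third inequalities force [y t.+1 = y t]; for bit 1 the last two force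
    [y t.+1 = X ^ 2 ^ t * y t]. The bits are those of [e] by uniqueness of the binary expansion. *)
Lemma chain_values (X M e L : nat) (y b : nat -> nat) :
  y 0 = 1 ->
  (forall t, t < L -> [/\ b t <= 1, y t <= y t.+1, y t.+1 <= y t + M * b t,
     y t.+1 <= X ^ 2 ^ t * y t & X ^ 2 ^ t * y t + M * b t <= y t.+1 + M]) ->
  e = \sum_(t < L) 2 ^ t * b t ->
  (forall t, t < L -> b t = e %/ 2 ^ t %% 2) /\
  (forall t, t <= L -> y t = X ^ (e %% 2 ^ t)).
Proof.
move=> y0 step def_e.
have bits t : t < L -> b t = e %/ 2 ^ t %% 2.
  move=> lt_tL; pose B s := if s < L then b s else 0.
  have {}def_e : e = \sum_(s < L) 2 ^ s * B s.
    by rewrite def_e; apply: eq_bigr => s _; rewrite /B ltn_ord.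
  rewrite def_e base_sum_digit /B ?lt_tL // => s.
  by case: ifP => // /step[].
split=> // t; elim: t => [|t IHt] lt_tL; first by rewrite y0 modn1.
have [b_le1 s1 s2 s3 s4] := step t lt_tL.
rewrite modn_exp2S -bits // expnD -IHt 1?ltnW //.
move: b_le1 s2 s4; case: (b t) => [|[|//]] _ s2 s4.
  by rewrite muln0 muln1; lia.
by rewrite muln1 mulnC; lia.
Qed.

(** After the three [alpha] variables, powers and bits alternate as in [chain]. *)
Definition ypos (t : nat) : nat := 3 + 2 * t.
Definition bpos (t : nat) : nat := 4 + 2 * t.

Definition term (u : nat) : affine := ([:: (1, u)], 0).
Definition constant (c : nat) : affine := ([::], c).

Definition chain_step (X M t : nat) : seq constraint :=
  [:: (term (bpos t), constant 1); (term (ypos t), term (ypos t.+1));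
      (term (ypos t.+1), ([:: (1, ypos t); (M, bpos t)], 0));
      (term (ypos t.+1), ([:: (X ^ 2 ^ t, ypos t)], 0));
      (([:: (X ^ 2 ^ t, ypos t); (M, bpos t)], 0), ([:: (1, ypos t.+1)], M))].

Definition exponent (L : nat) : seq (nat * nat) :=
  [seq (2 ^ t, bpos t) | t <- iota 0 L].

(** Variable 3 is the first power, fixed to 1. The last two inequalities say [0 <= i < n] for
    [i = m - e], where [e] is the encoded exponent. *)
Definition index_constraints (n m L : nat) : seq constraint :=
  [:: (constant 1, term 3); (term 3, constant 1);
      ((exponent L, 0), constant m); (constant m.+1, (exponent L, n))].

(* [T] is the index of the first of [H, c1, c2, c3, Q], which precede the five
   selection variables; [y] is the index of [X ^ (m - i)], and [gamma ^ i] is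
   represented as [g * X ^ (m - i) - N * Q].  A selection variable equal to 1
   switches on the equations multiplied by the large constant [2 * g]. *)
Definition select_constraints (Z X m g N y T : nat) : seq constraint :=
  let quotient := [:: (X ^ m * X, T); (X ^ m, T.+1); (X ^ m * g, T.+2);
                      (X ^ m * (g * g), T.+3)] in
  let K := 2 * g in
  let c1 := T.+1 in let c2 := T.+2 in let c3 := T.+3 in let Q := T.+4 in
  let x1 := Q.+1 in let x2 := Q.+2 in let x3 := Q.+3 in let x4 := Q.+4 in
  let x5 := Q.+4.+1 in
  let xs := [:: (1, x1); (1, x2); (1, x3); (1, x4); (1, x5)] in
  [:: ((quotient, 0), ([:: (Z, y)], 0)); (([:: (Z, y)], 1), (quotient, X ^ m));
      (([:: (1, c1)], 1), constant g); (([:: (1, c2)], 1), constant g);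
      (([:: (1, c3)], 1), constant g);
      (([:: (N, Q)], 0), ([:: (g, y)], 0)); (([:: (g, y)], 1), ([:: (N, Q)], N));
      ((xs, 0), constant 1); (constant 1, (xs, 0));
      (term 2, ([:: (1, x4); (1, x5)], 0)); (([:: (1, x4); (1, x5)], 0), term 2);
      (([:: (1, 0); (K, x1)], 0), ([:: (1, c1)], K));
      (([:: (1, c1); (K, x1)], 0), ([:: (1, 0)], K));
      (([:: (1, 0); (K, x2)], 0), ([:: (1, c2)], K));
      (([:: (1, c2); (K, x2)], 0), ([:: (1, 0)], K));
      (([:: (1, 0); (K, x3)], 0), ([:: (1, c3)], K));
      (([:: (1, c3); (K, x3)], 0), ([:: (1, 0)], K));
      (([:: (1, 0); (K, x4); (K, x5)], 0), constant K);
      (([:: (1, 1); (N, Q); (K, x1); (K, x2); (K, x4)], 0), ([:: (g, y)], K));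
      (([:: (g, y); (K, x1); (K, x2); (K, x4)], 0), ([:: (1, 1); (N, Q)], K));
      (([:: (1, 1); (2 * N, Q); (K, x3)], 0), ([:: (2 * g, y)], K));
      (([:: (2 * g, y); (K, x3)], 0), ([:: (1, 1); (2 * N, Q)], K));
      (([:: (1, 1); (K, x5)], 0), constant K)].

Definition alpha_list (c1 c2 c3 v k : nat) : seq nat :=
  nth [::] [:: [:: c1; v; 0]; [:: c2; v; 0]; [:: c3; 2 * v; 0];
               [:: 0; v; 1]; [:: 0; 0; 1]] k.

Definition chi_list (k : nat) : seq nat := [seq (t == k : nat) | t <- iota 0 5].

(* Under the selector values [x1, ..., x5], these inequalities between [a1], [a2]
   and the candidates [c1, c2, c3] and [gy - Nq] are equations or void. *)
Definition switched (g gy Nq a1 a2 c1 c2 c3 x1 x2 x3 x4 x5 : nat) : Prop :=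
  [/\ [/\ a1 + 2 * g * x1 <= c1 + 2 * g, c1 + 2 * g * x1 <= a1 + 2 * g,
          a1 + 2 * g * x2 <= c2 + 2 * g & c2 + 2 * g * x2 <= a1 + 2 * g],
      [/\ a1 + 2 * g * x3 <= c3 + 2 * g, c3 + 2 * g * x3 <= a1 + 2 * g &
          a1 + 2 * g * x4 + 2 * g * x5 <= 2 * g] &
      [/\ a2 + Nq + 2 * g * x1 + 2 * g * x2 + 2 * g * x4 <= gy + 2 * g,
          gy + 2 * g * x1 + 2 * g * x2 + 2 * g * x4 <= a2 + Nq + 2 * g,
          a2 + 2 * Nq + 2 * g * x3 <= 2 * gy + 2 * g,
          2 * gy + 2 * g * x3 <= a2 + 2 * Nq + 2 * g &
          a2 + 2 * g * x5 <= 2 * g]].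

(** The constant [2 * g] is large enough: candidates for [a1] are below [g] and those for [a2] at
    most [2 * g], so every inequality that is switched off holds for the selected vector. *)
Lemma switchedP (g gy Nq v a1 a2 a3 c1 c2 c3 x1 x2 x3 x4 x5 k : nat) :
  c1 < g -> c2 < g -> c3 < g -> v <= g -> gy = Nq + v -> a3 = x4 + x5 -> k < 5 ->
  [:: x1; x2; x3; x4; x5] = chi_list k ->
  switched g gy Nq a1 a2 c1 c2 c3 x1 x2 x3 x4 x5 <->
  [:: a1; a2; a3] = alpha_list c1 c2 c3 v k.
Proof.
move=> lt1 lt2 lt3 le_v -> ->.
case: k => [|[|[|[|[|[]]]]]] // _ [-> -> -> -> ->]; rewrite /switched !muln0 !muln1 !addn0.
- split=> [[[? ? ? ?] [? ? ?] [? ? ? ? ?]]|[-> ->]]; last by do !split; lia.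
  by congr [:: _; _; _]; lia.
- split=> [[[? ? ? ?] [? ? ?] [? ? ? ? ?]]|[-> ->]]; last by do !split; lia.
  by congr [:: _; _; _]; lia.
- split=> [[[? ? ? ?] [? ? ?] [? ? ? ? ?]]|[-> ->]]; last by do !split; lia.
  by congr [:: _; _; _]; lia.
- split=> [[[? ? ? ?] [? ? ?] [? ? ? ? ?]]|[-> ->]]; last by do !split; lia.
  by congr [:: _; _; _]; lia.
split=> [[[? ? ? ?] [? ? ?] [? ? ? ? ?]]|[-> ->]]; last by do !split; lia.
by congr [:: _; _; _]; lia.
Qed.

Definition selection (Z X m g N y a1 a2 a3 h c1 c2 c3 q x1 x2 x3 x4 x5 : nat) : Prop :=
  [/\ [/\ X ^ m * (c1 + g * (c2 + g * (c3 + g * h))) <= Z * y <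
            X ^ m * (c1 + g * (c2 + g * (c3 + g * h))) + X ^ m,
          c1 < g, c2 < g & c3 < g],
      [/\ q * N <= g * y < q.+1 * N, x1 + x2 + x3 + x4 + x5 = 1 & a3 = x4 + x5] &
      switched g (g * y) (q * N) a1 a2 c1 c2 c3 x1 x2 x3 x4 x5].

Lemma select_constraintsP (Z X m g N y T : nat) (v : nat -> nat) :
  X = g * g * g ->
  reflect (selection Z X m g N (v y) (v 0) (v 1) (v 2) (v T) (v T.+1) (v T.+2)
             (v T.+3) (v T.+4) (v T.+4.+1) (v T.+4.+2) (v T.+4.+3) (v T.+4.+4)
             (v T.+4.+4.+1))
          (all (holds v) (select_constraints Z X m g N y T)).
Proof.
move=> defX; rewrite /select_constraints /holds /eval /=.
rewrite !big_cons !big_nil /= !mul1n !addn0 !addn1 !add0n !addnA.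
have -> : X ^ m * X * v T + X ^ m * v T.+1 + X ^ m * g * v T.+2
       + X ^ m * (g * g) * v T.+3 =
    X ^ m * (v T.+1 + g * (v T.+2 + g * (v T.+3 + g * v T))).
  by rewrite [in X in _ * X * _]defX; move: (X ^ m) => P; ring.
apply: (iffP idP).
  (* There are 23 inequalities, hence 22 conjunctions to split before the last one. *)
  do 22! case/andP => ?; rewrite andbT => ?.
  by rewrite /selection /switched; do !split; lia.
case=> [[/andP[? ?] ? ? ?] [/andP[? ?] ? ?] [[? ? ? ?] [? ? ?] [? ? ? ? ?]]].
by do 22! (apply/andP; split; first by lia); lia.
Qed.

Lemma chi_list_exists (x1 x2 x3 x4 x5 : nat) :
  x1 + x2 + x3 + x4 + x5 = 1 ->
  exists2 k, k < 5 & [:: x1; x2; x3; x4; x5] = chi_list k.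
Proof.
case: x1 => [|[|x1]]; last by lia.
  case: x2 => [|[|x2]]; last by lia.
    case: x3 => [|[|x3]]; last by lia.
      case: x4 => [|[|x4]]; last by lia.
        by exists 4 => //; congr [:: _; _; _; _; _]; lia.
      by exists 3 => //; congr [:: _; _; _; _; _]; lia.
    by exists 2 => //; congr [:: _; _; _; _; _]; lia.
  by exists 1 => //; congr [:: _; _; _; _; _]; lia.
by exists 0 => //; congr [:: _; _; _; _; _]; lia.
Qed.

(** Once [y] is the right power, quotient, digits and remainder are forced, and the only freedom
    left is the choice [k] of one of the five vectors. *)
Lemma selection_values (gamma g m i Z X N y a1 a2 a3 h c1 c2 c3 q x1 x2 x3 x4 x5 : nat) :
  2 < gamma -> i <= m -> g = gamma ^ m -> X = g * g * g -> N = gamma * X - 1 ->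
  y = X ^ (m - i) ->
  selection Z X m g N y a1 a2 a3 h c1 c2 c3 q x1 x2 x3 x4 x5 <->
  [/\ [:: h; c1; c2; c3; q] = tail_digits gamma g (Z %/ X ^ i) y
    & exists2 k, k < 5 & [:: a1; a2; a3] = alpha_list c1 c2 c3 (gamma ^ i) k
        /\ [:: x1; x2; x3; x4; x5] = chi_list k].
Proof.
move=> gamma_gt2 le_im def_g def_X def_N def_y.
have gamma_gt0 : 0 < gamma by lia.
have g_gt0 : 0 < g by rewrite def_g expn_gt0 gamma_gt0.
have X_gt0 : 0 < X by rewrite def_X !muln_gt0 g_gt0.
have le_gX : g <= X by rewrite def_X -mulnA leq_pmulr ?muln_gt0 ?g_gt0.
have N_gt0 : 0 < N by rewrite def_N; nia.
have pow_i : g * y %% N = gamma ^ i by rewrite def_N def_y inverse_power.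
have le_v : gamma ^ i <= g by rewrite def_g leq_pexp2l.
have def_gy := divn_eq (g * y) N; rewrite pow_i in def_gy.
rewrite /tail_digits -def_X -def_N; split.
  case=> [[ZE lt1 lt2 lt3] [qE xE a3E] sw].
  have /eqP defR : Z %/ X ^ i == c1 + g * (c2 + g * (c3 + g * h)).
    by rewrite -(@shift_bounds X m) // -def_y.
  have [m1 m2 m3 d4] := digits3 h lt1 lt2 lt3.
  rewrite -def_X in d4; rewrite divn_eq_bounds // in qE; move/eqP: qE => def_q.
  rewrite defR m1 m2 m3 d4 def_q; split=> //; rewrite def_q in def_gy.
  have [k lt_k5 def_x] := chi_list_exists xE.
  exists k => //; split=> //.
  by apply/(switchedP _ _ lt1 lt2 lt3 le_v def_gy a3E lt_k5 def_x).
case=> -[-> -> -> -> ->] [k lt_k5 [def_a def_x]].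
set R := Z %/ X ^ i.
have ltc c : c %% g < g by rewrite ltn_mod.
have defR : R = R %% g + g * (R %/ g %% g + g * (R %/ g %/ g %% g + g * (R %/ X))).
  have expand a : a %% g + g * (a %/ g) = a by rewrite mulnC addnC -divn_eq.
  by rewrite def_X !divnMA !expand.
have lt1 := ltc R; have lt2 := ltc (R %/ g); have lt3 := ltc (R %/ g %/ g).
move: (R %% g) (R %/ g %% g) (R %/ g %/ g %% g) (R %/ X) lt1 lt2 lt3 defR def_a.
move=> d1 d2 d3 d4 lt1 lt2 lt3 defR def_a.
have ZE :
    X ^ m * (d1 + g * (d2 + g * (d3 + g * d4))) <= Z * y <
    X ^ m * (d1 + g * (d2 + g * (d3 + g * d4))) + X ^ m.
  by rewrite def_y shift_bounds // -defR.
have qE : g * y %/ N * N <= g * y < (g * y %/ N).+1 * N by rewrite divn_eq_bounds.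
have [xE a3E] : x1 + x2 + x3 + x4 + x5 = 1 /\ a3 = x4 + x5.
  by case: k lt_k5 def_a def_x => [|[|[|[|[|[]]]]]] // _ [_ _ ->] [-> -> -> -> ->].
split=> //.
by apply/(switchedP _ _ lt1 lt2 lt3 le_v def_gy a3E lt_k5 def_x).
Qed.

Definition system (n m Z X g N L : nat) : seq constraint :=
  flatten [seq chain_step X (X ^ 2 ^ L) t | t <- iota 0 L] ++
  index_constraints n m L ++ select_constraints Z X m g N (ypos L) (ypos L).+1.

Lemma iota_index (L : nat) : iota 0 L = index_iota 0 L.
Proof. by rewrite /index_iota subn0. Qed.

(** Five inequalities per chain step, 4 for the index and 23 for the selection. *)
Lemma size_system (n m Z X g N L : nat) : size (system n m Z X g N L) = 5 * L + 27.
Proof.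
rewrite /system 2!size_cat; congr (_ + _); rewrite size_flatten /shape -map_comp.
rewrite sumnE big_map (eq_bigr (fun=> 5)) // big_const_seq count_predT size_iota.
by rewrite iter_addn addn0.
Qed.

Lemma eval_exponent (L c : nat) (v : nat -> nat) :
  eval (exponent L, c) v = \sum_(t < L) 2 ^ t * v (bpos t) + c.
Proof. by rewrite /eval big_map iota_index big_mkord. Qed.

Lemma sum_bits (L e : nat) : \sum_(t < L) 2 ^ t * (e %/ 2 ^ t %% 2) = e %% 2 ^ L.
Proof.
elim: L => [|L IHL]; first by rewrite big_ord0 modn1.
by rewrite big_ord_recr /= IHL -modn_exp2S.
Qed.

Lemma chain_stepP (X M t : nat) (v : nat -> nat) :
  reflect [/\ v (bpos t) <= 1, v (ypos t) <= v (ypos t.+1),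
              v (ypos t.+1) <= v (ypos t) + M * v (bpos t),
              v (ypos t.+1) <= X ^ 2 ^ t * v (ypos t) &
              X ^ 2 ^ t * v (ypos t) + M * v (bpos t) <= v (ypos t.+1) + M]
          (all (holds v) (chain_step X M t)).
Proof.
rewrite /chain_step /holds /eval /= !big_cons !big_nil /= !mul1n !addn0 andbT.
by apply: (iffP and5P).
Qed.

Lemma chain_stepsP (X M L : nat) (v : nat -> nat) :
  reflect (forall t, t < L -> all (holds v) (chain_step X M t))
          (all (holds v) (flatten [seq chain_step X M t | t <- iota 0 L])).
Proof.
apply: (iffP allP) => [hold t lt_tL|hold c /flatten_mapP[t]].
  by apply/allP => c c_t; apply: hold; apply/flatten_mapP; exists t; rewrite ?mem_iota.
by rewrite mem_iota => /andP[_ /hold/allP]; apply.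
Qed.

(** Converse of [chain_values]: [X ^ 2 ^ L] serves as big-M constant, because the exponent after
    step [t] is at most [2 ^ t.+1]. *)
Lemma chain_values_steps (X e L t : nat) : 0 < X -> t < L ->
  [/\ e %/ 2 ^ t %% 2 <= 1, X ^ (e %% 2 ^ t) <= X ^ (e %% 2 ^ t.+1),
      X ^ (e %% 2 ^ t.+1) <= X ^ (e %% 2 ^ t) + X ^ 2 ^ L * (e %/ 2 ^ t %% 2),
      X ^ (e %% 2 ^ t.+1) <= X ^ 2 ^ t * X ^ (e %% 2 ^ t) &
      X ^ 2 ^ t * X ^ (e %% 2 ^ t) + X ^ 2 ^ L * (e %/ 2 ^ t %% 2)
        <= X ^ (e %% 2 ^ t.+1) + X ^ 2 ^ L].
Proof.
move=> X_gt0 lt_tL; have b_lt2 : e %/ 2 ^ t %% 2 < 2 by rewrite ltn_mod.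
have le_L : 2 ^ t + e %% 2 ^ t <= 2 ^ L.
  apply: leq_trans (_ : 2 ^ t.+1 <= _); last by rewrite leq_exp2l.
  by rewrite expnS mul2n -addnn leq_add2l ltnW // ltn_mod expn_gt0.
have le_M : X ^ 2 ^ t * X ^ (e %% 2 ^ t) <= X ^ 2 ^ L by rewrite -expnD leq_pexp2l.
have le_y : X ^ (e %% 2 ^ t) <= X ^ 2 ^ t * X ^ (e %% 2 ^ t).
  by rewrite leq_pmull // expn_gt0 X_gt0.
rewrite modn_exp2S expnD; move: b_lt2; case: (_ %% 2) => [|[|b]] // _.
  by rewrite !muln0 !muln1; split; lia.
by rewrite !muln1 (mulnC (X ^ (e %% _))); split; lia.
Qed.

Definition matches (gamma m Z X g L : nat) (v : nat -> nat) (i k : nat) : Prop :=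
  let T := (ypos L).+1 in
  [/\ forall t, t < L -> v (bpos t) = (m - i) %/ 2 ^ t %% 2,
      forall t, t <= L -> v (ypos t) = X ^ ((m - i) %% 2 ^ t),
      [:: v T; v T.+1; v T.+2; v T.+3; v T.+4] =
        tail_digits gamma g (Z %/ X ^ i) (v (ypos L)),
      [:: v 0; v 1; v 2] = alpha_list (v T.+1) (v T.+2) (v T.+3) (gamma ^ i) k &
      [:: v T.+4.+1; v T.+4.+2; v T.+4.+3; v T.+4.+4; v T.+4.+4.+1] = chi_list k].

Lemma systemP (gamma n m Z : nat) (v : nat -> nat) :
  let g := gamma ^ m in let X := g * g * g in let L := digits 2 m in
  2 < gamma -> n <= m ->
  all (holds v) (system n m Z X g (gamma * X - 1) L) <->
  exists i k, [/\ i < n, k < 5 & matches gamma m Z X g L v i k].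
Proof.
move=> g X L gamma_gt2 le_nm.
have X_gt0 : 0 < X by rewrite !muln_gt0 expn_gt0 (leq_trans _ gamma_gt2).
have lt_m : m < 2 ^ L by rewrite ltnNge -digits_ltn // ltnn.
rewrite /system !all_cat; split.
  case/and3P => /chain_stepsP steps idx /(select_constraintsP _ _ _ _ _ _ (erefl X)) sel.
  have {steps} step t lt_tL := elimT (chain_stepP _ _ _ _) (steps t lt_tL).
  have [y_le1 y_ge1 e_le e_ge] : [/\ 1 <= v 3, v 3 <= 1,
      \sum_(t < L) 2 ^ t * v (bpos t) <= m &
      m.+1 <= \sum_(t < L) 2 ^ t * v (bpos t) + n].
    move: idx; rewrite /index_constraints /holds /= !eval_exponent /eval /=.
    by rewrite !big_cons !big_nil /= mul1n !addn0 andbT => /and4P[].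
  have y0 : v (ypos 0) = 1 by apply/eqP; rewrite eqn_leq y_ge1.
  have := chain_values y0 step erefl; set e := \sum_(t < L) _ => -[bits powers].
  have le_i : m - e <= m by apply: leq_subr.
  have def_e : m - (m - e) = e by rewrite subKn.
  (* As [e <= m < 2 ^ L], the last power carries the full exponent, so [m - e] is the encoded
     index. *)
  have yL : v (ypos L) = X ^ (m - (m - e)).
    by rewrite powers // def_e modn_small // (leq_ltn_trans e_le).
  have [tl [k lt_k5 [al ch]]] :=
    (selection_values _ _ _ _ _ _ _ _ _ _ _ _ _ _ gamma_gt2 le_i erefl erefl erefl yL).1 sel.
  exists (m - e), k; split=> //; first by lia.
  by split; rewrite ?def_e.
case=> i [k [lt_in lt_k5 [bits powers tl al ch]]].
have le_im : i <= m by apply: ltnW; apply: leq_trans le_nm.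
have lt_mi : m - i < 2 ^ L by apply: leq_ltn_trans lt_m; apply: leq_subr.
apply/and3P; split.
- apply/chain_stepsP => t lt_tL; apply/chain_stepP.
  rewrite bits // (powers t (ltnW lt_tL)) (powers t.+1 lt_tL).
  exact: chain_values_steps.
- have sumE : \sum_(t < L) 2 ^ t * v (bpos t) = m - i.
    rewrite (eq_bigr (fun t : 'I_L => 2 ^ t * ((m - i) %/ 2 ^ t %% 2))) => [|t _].
      by rewrite sum_bits modn_small.
    by rewrite bits.
  have y0 : v 3 = 1 by rewrite -[v 3]/(v (ypos 0)) powers // modn1.
  rewrite /index_constraints /holds /= !eval_exponent /eval /= sumE.
  by rewrite !big_cons !big_nil /= mul1n !addn0 andbT y0; apply/and4P; split; lia.
apply/(select_constraintsP _ _ _ _ _ _ (erefl X)).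
apply/(selection_values _ _ _ _ _ _ _ _ _ _ _ _ _ _ gamma_gt2 le_im erefl erefl erefl).
  by rewrite powers // modn_small.
by split=> //; exists k.
Qed.

(** * Feasible solutions as explicit vectors *)

Definition solution (gamma m Z i k : nat) : seq nat :=
  let g := gamma ^ m in let R := Z %/ (g * g * g) ^ i in
  alpha_list (R %% g) (R %/ g %% g) (R %/ g %/ g %% g) (gamma ^ i) k ++
    beta_seq gamma i Z ++ chi_list k.

Lemma size_beta_seq (gamma i Z : nat) :
  size (beta_seq gamma i Z) = 2 * digits 2 (width gamma Z) + 6.
Proof. by rewrite size_cat size_mkseq -addn1 -addnA. Qed.

Lemma size_alpha_list (c1 c2 c3 v k : nat) : k < 5 -> size (alpha_list c1 c2 c3 v k) = 3.
Proof. by case: k => [|[|[|[|[|[]]]]]]. Qed.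

Lemma nth_catl (a b : seq nat) (n u : nat) :
  size a = n -> u < n -> nth 0 (a ++ b) u = nth 0 a u.
Proof. by move=> <- lt_u; rewrite nth_cat lt_u. Qed.

Lemma nth_catr (a b : seq nat) (n u : nat) :
  size a = n -> nth 0 (a ++ b) (n + u) = nth 0 b u.
Proof. by move=> <-; rewrite nth_cat ltnNge leq_addr addKn. Qed.

Lemma matchesP (gamma m Z i k : nat) (v : nat -> nat) :
  let g := gamma ^ m in let X := g * g * g in let L := digits 2 m in
  width gamma Z = m -> k < 5 ->
  matches gamma m Z X g L v i k <->
  forall u, u < 3 + ((2 * L + 6) + 5) -> v u = nth 0 (solution gamma m Z i k) u.
Proof.
move=> g X L def_m lt_k5.
set s := solution _ _ _ _ _.
have size_a := size_alpha_list _ _ _ _ lt_k5.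
have size_b : size (beta_seq gamma i Z) = (2 * L).+1 + 5.
  by rewrite size_beta_seq def_m -/L; lia.
have beta_chain : beta_seq gamma i Z =
    chain X (m - i) L ++ tail_digits gamma g (Z %/ X ^ i) (X ^ ((m - i) %% 2 ^ L)).
  by rewrite /beta_seq def_m.
have size_c : size (chain X (m - i) L) = (2 * L).+1 by rewrite size_mkseq.
have s3 (u : nat) : u < 3 -> nth 0 s u = nth 0 (alpha_list
    ((Z %/ X ^ i) %% g) ((Z %/ X ^ i) %/ g %% g) ((Z %/ X ^ i) %/ g %/ g %% g)
    (gamma ^ i) k) u.
  by move=> lt_u3; rewrite (nth_catl _ (size_a _ _ _ _)).
have s_chain (u : nat) : u < (2 * L).+1 -> nth 0 s (3 + u) = chain_entry X (m - i) u.
  move=> lt_u; rewrite (nth_catr _ _ (size_a _ _ _ _)) (nth_catl _ size_b); last by lia.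
  by rewrite beta_chain (nth_catl _ size_c) // nth_mkseq.
have s_tail (w : nat) : w < 5 -> nth 0 s ((ypos L).+1 + w) =
    nth 0 (tail_digits gamma g (Z %/ X ^ i) (X ^ ((m - i) %% 2 ^ L))) w.
  move=> lt_w5; rewrite /ypos -addnS -addnA (nth_catr _ _ (size_a _ _ _ _)).
  by rewrite (nth_catl _ size_b) ?ltn_add2l // beta_chain (nth_catr _ _ size_c).
have s_chi (w : nat) : nth 0 s ((ypos L).+4.+2 + w) = nth 0 (chi_list k) w.
  rewrite (_ : _ + w = 3 + ((2 * L).+1 + 5 + w)); last by rewrite /ypos; lia.
  by rewrite (nth_catr _ _ (size_a _ _ _ _)) (nth_catr _ _ size_b).
split=> [[bits powers tl al ch] u lt_u|eq_v].
  have yL := powers L (leqnn L).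
  have [lt_u3|le_3u] := ltnP u 3.
    move: al; rewrite s3 //; move: tl; rewrite yL => -[_ -> -> -> _].
    move: (alpha_list _ _ _ _ _) => a def_a; rewrite -def_a.
    by case: u lt_u3 {lt_u} => [|[|[]]].
  have [lt_uL|le_Lu] := ltnP (u - 3) (2 * L).+1.
    rewrite -(subnKC le_3u) s_chain // /chain_entry.
    (* An odd offset in the chain is a bit, an even one a power. *)
    have := odd_double_half (u - 3); case: (odd _) => /= def_u.
      by rewrite -bits -?[bpos _]/(4 + _) ?/bpos; last lia; congr v; lia.
    by rewrite -powers /ypos; last lia; congr v; lia.
  have [lt_w|le_w] := ltnP u (ypos L).+4.+2.
    have [w lt_w5 ->] : exists2 w, w < 5 & u = (ypos L).+1 + w.
      by exists (u - (ypos L).+1); move: lt_w le_Lu le_3u; rewrite /ypos; lia.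
    rewrite s_tail // -yL -tl.
    by case: w lt_w5 => [|[|[|[|[|]]]]] // _; congr v; lia.
  have [w lt_w5 ->] : exists2 w, w < 5 & u = (ypos L).+4.+2 + w.
    by exists (u - (ypos L).+4.+2); move: lt_u le_w; rewrite /ypos; lia.
  rewrite s_chi -ch.
  by case: w lt_w5 => [|[|[|[|[|]]]]] // _; congr v; lia.
have powers t : t <= L -> v (ypos t) = X ^ ((m - i) %% 2 ^ t).
  move=> le_tL; rewrite eq_v /ypos; last lia.
  rewrite s_chain; last by lia.
  by rewrite /chain_entry mul2n odd_double /= doubleK.
have v_tail (w : nat) : w < 5 -> v ((ypos L).+1 + w) =
    nth 0 (tail_digits gamma g (Z %/ X ^ i) (X ^ ((m - i) %% 2 ^ L))) w.
  by move=> lt_w5; rewrite eq_v; [apply: s_tail | rewrite /ypos; lia].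
have tl : [:: v (ypos L).+1; v (ypos L).+2; v (ypos L).+3; v (ypos L).+4; v (ypos L).+4.+1]
    = tail_digits gamma g (Z %/ X ^ i) (v (ypos L)).
  by rewrite powers //; congr [:: _; _; _; _; _];
    [have := v_tail 0 | have := v_tail 1 | have := v_tail 2 | have := v_tail 3
    | have := v_tail 4]; rewrite ?addnS addn0 => ->.
split=> //.
- move=> t lt_tL; rewrite /bpos eq_v; last lia.
  rewrite (_ : 4 + _ = 3 + (2 * t).+1); last by lia.
  rewrite s_chain; last by lia.
  by rewrite /chain_entry mul2n /= odd_double /= uphalf_double.
- have := size_alpha_list ((Z %/ X ^ i) %% g) ((Z %/ X ^ i) %/ g %% g)
    ((Z %/ X ^ i) %/ g %/ g %% g) (gamma ^ i) lt_k5.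
  case: tl => _ -> -> -> _; rewrite 3?eq_v 3?s3 //.
  by case: (alpha_list _ _ _ _ _) => [|? [|? [|? []]]].
have v_chi (w : nat) : w < 5 -> v ((ypos L).+4.+2 + w) = nth 0 (chi_list k) w.
  by move=> lt_w5; rewrite eq_v; [apply: s_chi | rewrite /ypos; lia].
congr [:: _; _; _; _; _];
  [have := v_chi 0 | have := v_chi 1 | have := v_chi 2 | have := v_chi 3
  | have := v_chi 4]; rewrite ?addnS addn0 => ->; by [].
Qed.

Lemma Zval_digits (gamma n m : nat) (j k l : 'I_n -> 'I_m) (i : 'I_n) :
  1 < gamma ->
  let g := gamma ^ m in let R := Zval gamma j k l %/ (g * g * g) ^ i in
  [/\ R %% g = gamma ^ j i, R %/ g %% g = gamma ^ k i & R %/ g %/ g %% g = gamma ^ l i].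
Proof.
move=> gamma_gt1 g R.
have defX : gamma ^ (3 * m) = g * g * g by rewrite -!expnD; congr (_ ^ _); lia.
have := Zval_digit j k l i gamma_gt1; rewrite defX -/g -/R => digitR.
have lt_g (c : 'I_m) : gamma ^ c < g by rewrite ltn_exp2l.
have [] := digits3 (R %/ (g * g * g)) (lt_g (j i)) (lt_g (k i)) (lt_g (l i)).
suff -> : gamma ^ j i + g * (gamma ^ k i + g * (gamma ^ l i + g * (R %/ (g * g * g)))) = R.
  by move=> -> -> ->.
by rewrite [RHS](divn_eq R (g * g * g)) digitR /block; ring.
Qed.

Lemma solution_feasible (gamma n m : nat) (j k l : 'I_n -> 'I_m)
    (g := gamma ^ m) (L := digits 2 m) (x : 'cV[int]_(3 + ((2 * L + 6) + 5))) :
  let Z := Zval gamma j k l in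
  let cs := system n m Z (g * g * g) g (gamma * (g * g * g) - 1) L in
  2 < gamma -> n <= m <= 3 * n ->
  feasible (ilp_matrix _ cs) (ilp_rhs cs) x <->
  exists (i : 'I_n) (s : 'I_5), x = colz _ (solution gamma m Z i s).
Proof.
move=> Z cs gamma_gt2 /andP[le_nm le_m3n].
have gamma_gt1 : 1 < gamma := ltnW gamma_gt2.
(* Recovering [m] from [Z] needs [0 < n], which the existence of an index provides. *)
have defm (i : nat) : i < n -> width gamma Z = m.
  by move=> lt_in; apply: width_Zval => //; apply: leq_ltn_trans lt_in.
have sys v := @systemP gamma n m Z v gamma_gt2 le_nm.
rewrite feasible_ilp; split.
  case/andP => /forallP x_ge0 /sys[i [s [lt_in lt_s5]]].
  move/(matchesP _ _ (defm i lt_in) lt_s5) => eq_x.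
  by exists (Ordinal lt_in), (Ordinal lt_s5); apply: colz_entry.
case=> i [s def_x].
have size_s : size (solution gamma m Z i s) = 3 + ((2 * L + 6) + 5).
  by rewrite /solution size_cat size_alpha_list // size_cat size_beta_seq (defm i).
rewrite def_x; apply/andP; split; first by apply/forallP => w; rewrite mxE.
apply/sys; exists i, s; split=> //.
by apply/(matchesP _ _ (defm i (ltn_ord i)) (ltn_ord s)) => u _; apply: entry_colz.
Qed.

Lemma solution_parts (gamma n m : nat) (j k l : 'I_n -> 'I_m) (i : 'I_n) (s : 'I_5) :
  let Z := Zval gamma j k l in
  let p := 2 * digits 2 m + 6 in
  let x := colz (3 + (p + 5)) (solution gamma m Z i s) in
  1 < gamma -> width gamma Z = m ->
  [/\ alpha_part x = nth 0%R (alphas gamma j k l i) s,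
      beta_part x = colz p (beta_seq gamma i Z) & chi_part x = colz 5 (chi_list s)].
Proof.
move=> Z p x gamma_gt1 defm.
have [def1 def2 def3] := Zval_digits j k l i gamma_gt1.
have size_b : size (beta_seq gamma i Z) = p by rewrite size_beta_seq defm.
rewrite /x /solution def1 def2 def3.
have [-> -> ->] := colz_parts 5 (chi_list s)
  (size_alpha_list (gamma ^ j i) (gamma ^ k i) (gamma ^ l i) (gamma ^ i) (ltn_ord s)) size_b.
by split=> //; case: s {x} => [[|[|[|[|[|[]]]]]]].
Qed.

(** * Distinctness of the solutions *)

(** The last power of the chain, [X ^ (m - i)] with [X > 1], already determines [i]. *)
Lemma beta_seq_inj (gamma m Z i i' : nat) :
  1 < gamma -> 0 < m -> i <= m -> i' <= m -> width gamma Z = m ->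
  beta_seq gamma i Z = beta_seq gamma i' Z -> i = i'.
Proof.
move=> gamma_gt1 m_gt0 le_im le_im' defm; set L := digits 2 m.
have lt_m : m < 2 ^ L by rewrite ltnNge -digits_ltn // ltnn.
have g_gt1 : 1 < gamma ^ m by rewrite -(expn0 gamma) ltn_exp2l.
have nthE a : nth 0 (beta_seq gamma a Z) (2 * L) =
    (gamma ^ m * gamma ^ m * gamma ^ m) ^ (m - a).
  rewrite /beta_seq defm -/L nth_cat size_mkseq ltnSn nth_mkseq //.
  rewrite /chain_entry mul2n odd_double doubleK modn_small //.
  by apply: leq_ltn_trans lt_m; apply: leq_subr.
move/(congr1 (nth 0 ^~ (2 * L))); rewrite !nthE => /eqP.
rewrite eqn_exp2l => [/eqP|]; first by lia.
by rewrite -mulnA (leq_trans g_gt1) // leq_pmulr // muln_gt0 (ltnW g_gt1).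
Qed.

Lemma chi_list_inj (s s' : nat) : s < 5 -> chi_list s = chi_list s' -> s = s'.
Proof.
move=> lt_s5 /(congr1 (nth 0 ^~ s)); rewrite /= !(nth_map 0) ?size_iota //.
by rewrite nth_iota // eqxx; case: eqP.
Qed.

(** The third coordinate separates the first three vectors from the last two, the second tells apart
    [0], [gamma ^ i] and its double, and [j i <> k i] separates the two positive occurrences. *)
Lemma alphas_inj (gamma n m : nat) (j k l : 'I_n -> 'I_m) (i : 'I_n) (s s' : 'I_5) :
  1 < gamma -> j i <> k i ->
  nth 0%R (alphas gamma j k l i) s = nth 0%R (alphas gamma j k l i) s' -> s = s'.
Proof.
move=> gamma_gt1 neq_jk.
have neq_c : gamma ^ j i <> gamma ^ k i.
  by move/eqP; rewrite eqn_exp2l // => /eqP/val_inj.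
have pow_gt0 a : 0 < gamma ^ a by rewrite expn_gt0 (ltnW gamma_gt1).
rewrite /alphas; have := pow_gt0 (j i); have := pow_gt0 (k i); have := pow_gt0 (l i).
have := pow_gt0 i.
move: (gamma ^ j i) (gamma ^ k i) (gamma ^ l i) (gamma ^ i) neq_c => c1 c2 c3 v.
case: s s' => [[|[|[|[|[|[]]]]]] // ?] [[|[|[|[|[|[]]]]]] // ?] ? ? ? ? ? /=;
  first [by move=> _; apply: val_inj | by move/colz_inj => /(_ erefl erefl) [] *; lia].
Qed.

Local Open Scope ring_scope.

Theorem theorem10 :
  exists (c : nat)                              (* constant of all the O() bounds *)
         (beta : nat -> nat -> nat -> seq nat)  (* beta gamma i Z *)
         (P : prog) (d e : nat),                (* computes beta in time d * size ^ e *)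
  forall (gamma n m : nat) (phi : cnf n m) (j k l : 'I_n -> 'I_m),
    (3 < gamma)%N ->
    is_3sat phi ->
    twice_pos_once_neg phi ->
    occurrence_indices phi j k l ->
    let Z := Zval gamma j k l in
    (forall i : 'I_n,
       computes_within P [:: gamma; nat_of_ord i; Z] (beta gamma i Z)
         (d * (bitlen i + bitlen Z) ^ e)%N) /\
    exists (p q r : nat) (A : 'M[int]_(r, 3 + (p + q))) (b : 'cV[int]_r),
      [/\ (3 + (p + q) <= c * (trunc_log 2 n).+1)%N,
          (r <= c * (trunc_log 2 n).+1)%N,
          (q <= c)%N &
          forall i : 'I_n, size (beta gamma i Z) = p] /\
      [/\ (exists S : seq 'cV[int]_(3 + (p + q)),
             [/\ uniq S, size S = (5 * n)%N &
                 forall x, (x \in S) = feasible A b x]),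
          (forall (i : 'I_n) (a : 'cV[int]_3), a \in alphas gamma j k l i ->
             exists! x : 'cV[int]_(3 + (p + q)),
               [/\ feasible A b x, alpha_part x = a &
                   beta_part x = colz p (beta gamma i Z)]),
          (forall x : 'cV[int]_(3 + (p + q)), feasible A b x ->
             exists (i : 'I_n),
               alpha_part x \in alphas gamma j k l i /\
               beta_part x = colz p (beta gamma i Z)) &
          (forall x : 'cV[int]_(3 + (p + q)), feasible A b x ->
             forall t : 'I_q, chi_part x t 0 = 0 \/ chi_part x t 0 = 1)].
Proof.
(* With [L <= trunc_log 2 n + 3], the [5 * L + 27] constraints number at most
   [5 * trunc_log 2 n + 42]. *)
exists 42%N, beta_seq, beta_prog, 3300%N, 4%N.
move=> gamma n m phi j k l gamma_gt3 phi3 phi21 occ Z.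
have gamma_gt1 : (1 < gamma)%N by apply: leq_trans gamma_gt3.
have gamma_gt2 : (2 < gamma)%N by apply: leq_trans gamma_gt3.
have bounds_m := clause_count_bounds phi3 phi21.
have /andP[le_nm le_m3n] := bounds_m.
split=> [i|]; first exact: beta_time phi3 phi21.
have defm (i : 'I_n) : width gamma Z = m.
  by apply: width_Zval => //; apply: leq_ltn_trans (ltn_ord i).
(* Equal indices would leave a single positive occurrence instead of two. *)
have neq_jk (i : 'I_n) : j i <> k i.
  move=> eq_jk; have [+ _] := phi21 i; rewrite /occurrences.
  by have [-> _] := occ i; rewrite cards2 eq_jk eqxx.
pose L := digits 2 m; pose g := (gamma ^ m)%N.
pose cs := system n m Z (g * g * g)%N g (gamma * (g * g * g) - 1)%N L.
pose A := ilp_matrix (3 + ((2 * L + 6) + 5))%N cs; pose b := ilp_rhs cs.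
have feas := @solution_feasible gamma n m j k l _ gamma_gt2 bounds_m.
have parts (i : 'I_n) (s : 'I_5) := @solution_parts gamma n m j k l i s gamma_gt1 (defm i).
(* From [m <= 3 * n < 4 * 2 ^ (trunc_log 2 n).+1]; for [n = 0] also [m = 0]. *)
have le_L : (L <= trunc_log 2 n + 3)%N.
  have [n0|n_gt0] := posnP n; first by rewrite /L (_ : m = 0%N) //; lia.
  have : (m < 2 ^ (trunc_log 2 n + 3))%N.
    have := trunc_log_ltn n (ltnSn 1); rewrite expnS addnC expnD; lia.
  by rewrite ltnNge -digits_ltn // -leqNgt.
pose sol (i : 'I_n) (s : 'I_5) := colz (3 + ((2 * L + 6) + 5))%N (solution gamma m Z i s).
have beta_inj (i i' : 'I_n) : colz (2 * L + 6)%N (beta_seq gamma i Z) =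
    colz (2 * L + 6)%N (beta_seq gamma i' Z) -> i = i'.
  move/colz_inj; rewrite !size_beta_seq (defm i) => /(_ erefl erefl) eq_b.
  apply: val_inj; apply: beta_seq_inj (defm i) eq_b => //.
  - exact: leq_ltn_trans (leq0n _) (leq_trans (ltn_ord i) le_nm).
  - exact: ltnW (leq_trans (ltn_ord i) le_nm).
  exact: ltnW (leq_trans (ltn_ord i') le_nm).
exists (2 * L + 6)%N, 5%N, (size cs), A, b; split; first split=> //.
- by lia.
- by rewrite size_system; lia.
- by move=> i; rewrite size_beta_seq (defm i).
split.
- exists [seq sol i s | i <- enum 'I_n, s <- enum 'I_5]; split.
  + apply: allpairs_uniq; rewrite ?enum_uniq // => -[i s] [i' s'] _ _ /= eq_sol.
    have [_ b1 c1] := parts i s; have [_ b2 c2] := parts i' s'.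
    rewrite -/(sol i s) eq_sol in b1 c1; rewrite -/(sol i' s') in b2 c2.
    (* The [beta] part identifies [i], and the [chi] part identifies [s]. *)
    have /beta_inj <- := etrans (esym b1) b2; congr (_, _); apply: val_inj.
    apply: (chi_list_inj (ltn_ord s)); apply: (@colz_inj 5) => //.
    by rewrite -c1.
  + by rewrite size_allpairs !size_enum_ord mulnC.
  + move=> x; apply/allpairsP/idP => [[[i s] [_ _ ->]]|/feas[i [s ->]]].
      by apply/feas; exists i, s.
    by exists (i, s); rewrite !mem_enum.
- move=> i a /(nthP 0)[s lt_s5 <-]; exists (sol i (Ordinal lt_s5)).
  have [a1 b1 _] := parts i (Ordinal lt_s5).
  split=> [|x [/feas[i' [s' ->]]]].
    by split=> //; apply/feas; exists i, (Ordinal lt_s5).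
  have [-> -> _] := parts i' s' => eq_a /beta_inj eq_i; subst i'.
  by rewrite (@alphas_inj _ _ _ _ _ _ _ _ (Ordinal lt_s5) gamma_gt1 (neq_jk i) eq_a).
- move=> x /feas[i [s ->]]; have [-> -> _] := parts i s; exists i; split=> //.
  exact: mem_nth.
move=> x /feas[i [s ->]] t; have [_ _ ->] := parts i s.
rewrite mxE (nth_map 0) ?size_iota //; case: eqP; by [right | left].
Qed.
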